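(* Let $(W,S)$ be a Coxeter group with weight function $L$, $L(s)>0$ for all $s\in S$, such that $W,L$ is bounded and satisfies P1–P15 (listed in the context). Let $A$ be a commutative ring with $1$. For functions $f,f':W\to A$ put $f''(z)=\sum_{x,y\in W}f(x)f'(y)\gamma_{x,y,z^{-1}}$ whenever these sums are finite. A function $f:W\to A$ is called left (resp. right) admissible if $\{w\in W:f(w)\ne0\}$ has finite intersection with every left (resp. right) cell of $W$. Then: (i) If $f,f'$ are both left admissible, then $f''$ is well defined (for each $z$ only finitely many terms are nonzero) and left admissible; if $f,f'$ are both right admissible, then $f''$ is well defined and right admissible. (ii) The $A$-module $\check{}J_A$ (resp. $J\check{}_A$) of formal sums $\sum_{w\in W}f(w)t_w$ with $f$ left (resp. right) admissible, with product $\left(\sum_xf(x)t_x\right)\left(\sum_yf'(y)t_y\right)=\sum_zf''(z)t_z$, is an associative $A$-algebra with unit element $\sum_{d\in\mathcal D}n_dt_d$. (iii) $\check J_A=\check{}J_A\cap J\check{}_A$ is a subalgebra (with the same unit element) of both $\check{}J_A$ and $J\check{}_A$, and it contains $J_A$ as a subalgebra.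
   Context: $(W,S)$ is a Coxeter group, $S$ finite, with length function $l$. A weight function is $L:W\to\mathbf Z$ with $L(ww')=L(w)+L(w')$ whenever $l(ww')=l(w)+l(w')$. $\mathcal A=\mathbf Z[v,v^{-1}]$. $\mathcal H$ is the $\mathcal A$-algebra with $1$ with generators $T_s$ ($s\in S$) and relations $(T_s-v^{L(s)})(T_s+v^{-L(s)})=0$ and $T_sT_{s'}T_s\cdots=T_{s'}T_sT_{s'}\cdots$ ($m_{s,s'}$ factors on each side, for $s\ne s'$ with $m_{s,s'}=\mathrm{ord}(ss')<\infty$); it has $\mathcal A$-basis $T_w=T_{s_1}\cdots T_{s_q}$ ($w=s_1\cdots s_q$ reduced). The bar involution is the ring involution of $\mathcal H$ with $\bar v=v^{-1}$, $\overline{T_s}=T_s^{-1}$. $c_w=\sum_y p_{y,w}T_y$ is the unique bar-invariant element with $p_{w,w}=1$ and $p_{y,w}\in v^{-1}\mathbf Z[v^{-1}]$ for $y\ne w$; the $c_w$ form an $\mathcal A$-basis. Write $T_xT_y=\sum_z f_{x,y,z}T_z$, $c_xc_y=\sum_z h_{x,y,z}c_z$. $W,L$ is bounded if there is $N\in\mathbf N$ with $v^{-N}f_{x,y,z}\in\mathbf Z[v^{-1}]$ for all $x,y,z$. Then for $z\in W$, $\mathbf a(z)$ is the smallest integer $\ge 0$ with $h_{x,y,z}\in v^{\mathbf a(z)}\mathbf Z[v^{-1}]$ for all $x,y$, and $\gamma_{x,y,z^{-1}}\in\mathbf Z$ is the coefficient of $v^{\mathbf a(z)}$ in $h_{x,y,z}$.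 Define $\Delta(z)\ge 0$ and $n_z\in\mathbf Z\setminus\{0\}$ by $p_{1,z}=n_zv^{-\Delta(z)}+$ strictly smaller powers of $v$, and $\mathcal D=\{z\in W:\mathbf a(z)=\Delta(z)\}$. For $I\subset S$, $W_I$ is the subgroup generated by $I$. $J_A$ is the $A$-algebra with $A$-basis $(t_w)_{w\in W}$ and product $t_xt_y=\sum_z\gamma_{x,y,z^{-1}}t_z$ (associative, possibly without unit), identified with the formal sums $\sum_w f(w)t_w$ with $f$ of finite support. Preorders: $w\leftarrow_{\mathcal L}w'$ (resp. $w\leftarrow_{\mathcal R}w'$) if $c_w$ has nonzero coefficient in $c_sc_{w'}$ (resp. $c_{w'}c_s$) for some $s\in S$; $\le_{\mathcal L}$, $\le_{\mathcal R}$ are the preorders (reflexive transitive closures) generated by these and $\le_{\mathcal{LR}}$ is generated by both. $\sim_{\mathcal L},\sim_{\mathcal R},\sim_{\mathcal{LR}}$ are the associated equivalence relations; their classes are the left, right, two-sided cells. P1. $\mathbf a(z)\le\Delta(z)$ for all $z\in W$. P2. If $d\in\mathcal D$ and $\gamma_{x,y,d}\neq0$ then $x=y^{-1}$. P3. For $y\in W$ there is a unique $d\in\mathcal D$ with $\gamma_{y^{-1},y,d}\ne0$. P4. If $z'\le_{\mathcal{LR}}z$ then $\mathbf a(z')\ge\mathbf a(z)$; hence $\mathbf a(z')=\mathbf a(z)$ if $z'\sim_{\mathcal{LR}}z$. P5. If $d\in\mathcal D$, $y\in W$, $\gamma_{y^{-1},y,d}\ne0$ then $\gamma_{y^{-1},y,d}=n_d=\pm1$.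 P6. If $d\in\mathcal D$ then $d^2=1$. P7. $\gamma_{x,y,z}=\gamma_{y,z,x}$ for all $x,y,z$. P8. If $\gamma_{x,y,z}\ne0$ then $x\sim_{\mathcal L}y^{-1}$, $y\sim_{\mathcal L}z^{-1}$, $z\sim_{\mathcal L}x^{-1}$. P9. If $z'\le_{\mathcal L}z$ and $\mathbf a(z')=\mathbf a(z)$ then $z'\sim_{\mathcal L}z$. P10. If $z'\le_{\mathcal R}z$ and $\mathbf a(z')=\mathbf a(z)$ then $z'\sim_{\mathcal R}z$. P11. If $z'\le_{\mathcal{LR}}z$ and $\mathbf a(z')=\mathbf a(z)$ then $z'\sim_{\mathcal{LR}}z$. P12. For $I\subset S$ and $y\in W_I$, $\mathbf a(y)$ computed in $(W_I,L|_{W_I})$ equals $\mathbf a(y)$ computed in $(W,L)$. P13. Any left cell $\Gamma$ contains a unique $d\in\mathcal D$, and $\gamma_{x^{-1},x,d}\ne0$ for all $x\in\Gamma$. P14. $z\sim_{\mathcal{LR}}z^{-1}$ for all $z$. P15. Let $v'$ be a second indeterminate and $h'_{x,y,z}\in\mathbf Z[v',v'^{-1}]$ be obtained from $h_{x,y,z}$ by $v\mapsto v'$. If $x,x',y,w\in W$ satisfy $\mathbf a(w)=\mathbf a(y)$, then $\sum_{y'}h'_{w,x',y'}h_{x,y',y}=\sum_{y'}h_{x,w,y'}h'_{y',x',y}$. *)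

(* Defs.v *)
From HB Require Import structures.
From Stdlib Require Import Relation_Operators.
From mathcomp Require Import all_boot all_algebra finmap.
From mathcomp Require Import boolp classical_sets functions cardinality fsbigop.
From mathcomp Require Import monalg.

Set Implicit Arguments.
Unset Strict Implicit.
Unset Printing Implicit Defensive.

Import GRing.Theory Num.Theory.
Local Open Scope classical_set_scope.
Local Open Scope ring_scope.

(** * Laurent polynomials *)

(* [laurent R] is R[v, v^-1], the group ring of Z over R. The library's ring
   structure on [{malg R[K]}] does not apply to K = int, since it requires a
   monoid K without invertible elements other than 1. *)
Definition laurent (R : comNzRingType) : Type := {malg R[int]}.

Section LaurentRing.
Variable R : comNzRingType.

HB.instance Definition _ := GRing.Zmodule.on (laurent R).

Implicit Types (f g : laurent R) (k : int).

(* the monomial c v^k *)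
Definition lmono (c : R) k : laurent R := << c *g k >>.

(* the coefficient of v^k *)
Definition lcoef f k : R := mcoeff k f.

Definition lmul f g : laurent R :=
  \sum_(i <- msupp f) \sum_(j <- msupp g)
    lmono (lcoef f i * lcoef g j) (i + j).

Local Open Scope fset_scope.

Lemma lmulw (d1 d2 : {fset int}) f g : msupp f `<=` d1 -> msupp g `<=` d2 ->
  lmul f g = \sum_(i <- d1) \sum_(j <- d2)
    lmono (lcoef f i * lcoef g j) (i + j).
Proof.
move=> le1 le2; rewrite /lmul (big_fset_incl _ le1) /=.
  apply: eq_bigr => i _; apply: big_fset_incl => // j _ /mcoeff_outdom e.
  by rewrite /lcoef e mulr0 /lmono monalgU0.
move=> i _ /mcoeff_outdom e.
by rewrite big1 // => j _; rewrite /lcoef e mul0r /lmono monalgU0.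
Qed.

Lemma lmulC : commutative lmul.
Proof.
move=> f g; rewrite /lmul exchange_big; apply: eq_bigr => j _.
by apply: eq_bigr => i _; rewrite mulrC addrC.
Qed.

Lemma lmulDl : left_distributive lmul +%R.
Proof.
move=> f1 f2 g; rewrite (lmulw (msuppD_le f1 f2) (fsubset_refl _)).
rewrite (lmulw (fsubsetUl (msupp f1) (msupp f2)) (fsubset_refl (msupp g))).
rewrite (lmulw (fsubsetUr (msupp f1) (msupp f2)) (fsubset_refl (msupp g))).
rewrite -big_split; apply: eq_bigr => i _.
rewrite -big_split; apply: eq_bigr => j _.
by rewrite /lcoef mcoeffD mulrDl /lmono monalgUD.
Qed.

Lemma lmul0l f : lmul 0 f = 0.
Proof. by rewrite /lmul msupp0 big_seq_fset0. Qed.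

Lemma lmulUU (a b : R) i j :
  lmul (lmono a i) (lmono b j) = lmono (a * b) (i + j).
Proof.
by rewrite (lmulw msuppU_le msuppU_le) !big_seq_fset1 /lcoef !mcoeffUU.
Qed.

Lemma lsum (f : laurent R) : f = \sum_(i <- msupp f) lmono (lcoef f i) i.
Proof. exact: monalgE. Qed.

Lemma lmul_suml (I : Type) (r : seq I) (F : I -> laurent R) g :
  lmul (\sum_(i <- r) F i) g = \sum_(i <- r) lmul (F i) g.
Proof.
exact: (big_morph (lmul^~ g) (fun x y => lmulDl x y g) (lmul0l g)).
Qed.

Lemma lmul_sumr (I : Type) (r : seq I) (F : I -> laurent R) g :
  lmul g (\sum_(i <- r) F i) = \sum_(i <- r) lmul g (F i).
Proof. by rewrite lmulC lmul_suml; apply: eq_bigr => i _; rewrite lmulC. Qed.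

Lemma lmulA : associative lmul.
Proof.
move=> f g h; rewrite [f]lsum !lmul_suml; apply: eq_bigr => i _.
rewrite [g]lsum lmul_suml !lmul_sumr lmul_suml; apply: eq_bigr => j _.
rewrite [h]lsum !lmul_sumr; apply: eq_bigr => k _.
by rewrite !lmulUU mulrA addrA.
Qed.

Lemma lmul1l : left_id (lmono 1 0) lmul.
Proof.
move=> f; rewrite [in LHS](lsum f) [in RHS](lsum f) lmul_sumr.
by apply: eq_bigr => i _; rewrite lmulUU mul1r add0r.
Qed.

Lemma lone_neq0 : lmono 1 0 != 0 :> laurent R.
Proof.
apply/eqP => /(congr1 (fun f => lcoef f 0)) /eqP.
by rewrite /lcoef /lmono mcoeffUU mcoeff0 oner_eq0.
Qed.

HB.instance Definition _ := GRing.Zmodule_isComNzRing.Build (laurent R)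
  lmulA lmulC lmul1l lmulDl lone_neq0.

End LaurentRing.

Notation Zv := (laurent int).

Definition vpow (k : int) : Zv := lmono 1 k.

(* x \in v^n Z[v^-1] *)
Definition deg_le (n : int) (x : Zv) : Prop :=
  forall k, n < k -> lcoef x k = 0.

(* The two embeddings of Z[v,v^-1] into the ring [laurent Zv] of Laurent
   polynomials in v' over Z[v,v^-1]: v |-> v and v |-> v'. *)
Definition in_v (x : Zv) : laurent Zv := lmono x 0.
Definition in_v' (x : Zv) : laurent Zv :=
  \sum_(k <- msupp x) lmono (lcoef x k)%:~R k.

(** * Coxeter groups *)

Section CoxeterGroup.
Variable W : groupType.
Implicit Types (S : set W) (w : W) (ws : seq W).

Inductive generated S : W -> Prop :=
| generated_in s : S s -> generated S s
| generated1 : generated S 1%g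
| generatedM x y : generated S x -> generated S y -> generated S (x * y)%g
| generatedV x : generated S x -> generated S x^-1%g.

Definition has_order w (m : nat) : Prop :=
  [/\ (0 < m)%N, (w ^+ m = 1)%g
    & forall k, (0 < k < m)%N -> (w ^+ k <> 1)%g].

(* Bourbaki's definition: W is generated by the finite set S of involutions,
   and the relations (s t)^(ord (s t)) = 1 present W. *)
Definition coxeter_system S : Prop :=
  [/\ finite_set S,
      forall s, S s -> has_order s 2,
      forall w, generated S w
    & forall (G : groupType) (phi : W -> G),
        (forall s t m, S s -> S t -> has_order (s * t)%g m ->
          ((phi s * phi t) ^+ m = 1)%g) ->
        exists g : {multiplicative W -> G}, forall s, S s -> g s = phi s].

Definition word S ws : Prop := forall s, s \in ws -> S s.

Definition len S w : nat :=
  xget 0%N [set n | (exists ws, [/\ word S ws, (\prod_(s <- ws) s)%g = w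
                                   & size ws = n])
                 /\ (forall ws, word S ws -> (\prod_(s <- ws) s)%g = w ->
                       (n <= size ws)%N)].

Definition reduced S ws : Prop :=
  word S ws /\ size ws = len S (\prod_(s <- ws) s)%g.

Definition weight_function S (L : W -> int) : Prop :=
  forall w w', len S (w * w')%g = (len S w + len S w')%N ->
    L (w * w')%g = L w + L w'.

Definition parabolic_pred (I : set W) : pred W := fun w => `[< generated I w >].

(* the subgroup W_I of W generated by I *)
Definition parabolic (I : set W) : Type := {w : W | parabolic_pred I w}.

Lemma parabolic_closed I : group_closed (parabolic_pred I).
Proof.
split=> [|x y /asboolP gx /asboolP gy]; apply/asboolP.
  exact: generated1.
by apply: generatedM => //; apply: generatedV.
Qed.

HB.instance Definition _ I := Choice.on (parabolic I).
HB.instance Definition _ I :=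
  SubType.copy (parabolic I) {w : W | parabolic_pred I w}.
HB.instance Definition _ I :=
  SubChoice_isSubGroup.Build W (parabolic_pred I) (parabolic I)
    (parabolic_closed I).

End CoxeterGroup.

(** * The Hecke algebra and the elements c_w *)

Section HeckeAlgebra.
Variables (W : groupType) (S : set W) (L : W -> int).

(* x y x ... (m factors) *)
Definition altprod (B : algType Zv) (x y : B) (m : nat) : B :=
  \prod_(i < m) (if odd i then y else x).

(* Only the values of t on S matter. *)
Definition hecke_relations (B : algType Zv) (t : W -> B) : Prop :=
  (forall s, S s ->
     (t s - vpow (L s) *: 1) * (t s + vpow (- L s) *: 1) = 0) /\
  (forall s s' m, S s -> S s' -> s <> s' -> has_order (s * s')%g m ->
     altprod (t s) (t s') m = altprod (t s') (t s) m).

Definition hecke_presentation (B : algType Zv) (t : W -> B) : Prop :=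
  hecke_relations t /\
  forall (C : algType Zv) (u : W -> C), hecke_relations u ->
    (exists g : {lrmorphism B -> C}, forall s, S s -> g (t s) = u s) /\
    (forall g g' : {lrmorphism B -> C},
       (forall s, S s -> g (t s) = g' (t s)) -> g =1 g').

Definition is_basis (B : algType Zv) (b : W -> B) : Prop :=
  forall x, exists! u : W -> Zv,
    finite_set [set w | u w != 0] /\ x = \sum_(w \in [set: W]) u w *: b w.

(* The algebra presented by the T_s together with the structures derived from
   it. All of them are determined by (W, S, L). [hT_basis] is the standard fact,
   a consequence of the presentation, that gives a meaning to the coefficients
   p and f; the basis property of the c_w, which does so for h, follows by
   unitriangularity. Sums over W are over the finite supports of these
   coefficients. *)
Record hecke_datum : Type := HeckeDatum {
  hA : algType Zv;
  hT : W -> hA;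
  hT_presentation : hecke_presentation hT;
  hT_reduced : forall ws, reduced S ws ->
    hT (\prod_(s <- ws) s)%g = \prod_(s <- ws) hT s;
  hT_basis : is_basis hT;
  hbar : {rmorphism hA -> hA};
  hbar_involutive : involutive hbar;
  hbar_v : hbar (vpow 1 *: 1) = vpow (-1) *: 1;
  hbar_T : forall s, S s -> hT s * hbar (hT s) = 1 /\ hbar (hT s) * hT s = 1;
  hc : W -> hA;
  hp : W -> W -> Zv; (* [hp y w] is p_{y,w} *)
  hp_finite : forall w, finite_set [set y | hp y w != 0];
  hc_def : forall w, hc w = \sum_(y \in [set: W]) hp y w *: hT y;
  hc_bar : forall w, hbar (hc w) = hc w;
  hp_diag : forall w, hp w w = 1;
  hp_neg : forall y w, y <> w -> deg_le (-1) (hp y w);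
  hf : W -> W -> W -> Zv;
  hf_finite : forall x y, finite_set [set z | hf x y z != 0];
  hf_def : forall x y, hT x * hT y = \sum_(z \in [set: W]) hf x y z *: hT z;
  hh : W -> W -> W -> Zv;
  hh_finite : forall x y, finite_set [set z | hh x y z != 0];
  hh_def : forall x y, hc x * hc y = \sum_(z \in [set: W]) hh x y z *: hc z
}.

Variable D : hecke_datum.

Definition bounded : Prop :=
  exists N : nat, forall x y z, deg_le N%:Z (hf D x y z).

Definition is_a_function (a : W -> nat) : Prop :=
  forall z, (forall x y, deg_le (a z)%:Z (hh D x y z)) /\
    (forall n : nat, (forall x y, deg_le n%:Z (hh D x y z)) -> (a z <= n)%N).

(* p_{1,z} = n_z v^(-Delta z) + strictly smaller powers of v *)
Definition is_Delta_n (Delta : W -> nat) (n : W -> int) : Prop :=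
  forall z, [/\ n z != 0, lcoef (hp D 1%g z) (- (Delta z)%:Z) = n z
              & deg_le (- (Delta z)%:Z) (hp D 1%g z)].

(* The third index of gamma is inverted: [gamma a x y z^-1] is the coefficient
   of v^(a z) in h_{x,y,z}. *)
Definition gamma (a : W -> nat) (x y z : W) : int :=
  lcoef (hh D x y z^-1%g) (a z^-1%g)%:Z.

Definition arrowL (w w' : W) : Prop := exists2 s, S s & hh D s w' w != 0.
Definition arrowR (w w' : W) : Prop := exists2 s, S s & hh D w' s w != 0.
Definition leL : W -> W -> Prop := clos_refl_trans W arrowL.
Definition leR : W -> W -> Prop := clos_refl_trans W arrowR.
Definition leLR : W -> W -> Prop :=
  clos_refl_trans W (fun w w' => arrowL w w' \/ arrowR w w').

Definition simL (x y : W) : Prop := leL x y /\ leL y x.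
Definition simR (x y : W) : Prop := leR x y /\ leR y x.
Definition simLR (x y : W) : Prop := leLR x y /\ leLR y x.

Definition left_cell (C : set W) : Prop := exists w, C = [set x | simL x w].
Definition right_cell (C : set W) : Prop := exists w, C = [set x | simR x w].

End HeckeAlgebra.

Definition distinguished (W : groupType) (a Delta : W -> nat) : set W :=
  [set z | a z = Delta z].

Record P1_to_P15 (W : groupType) (S : set W) (L : W -> int)
    (D : hecke_datum S L) (a Delta : W -> nat) (n : W -> int) : Prop := {
  P1 : forall z, (a z <= Delta z)%N;
  P2 : forall d x y, distinguished a Delta d -> gamma D a x y d != 0 ->
    x = y^-1%g;
  P3 : forall y, exists! d,
    distinguished a Delta d /\ gamma D a y^-1%g y d != 0;
  P4 : forall z z', leLR D z' z -> (a z <= a z')%N;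
  P5 : forall d y, distinguished a Delta d -> gamma D a y^-1%g y d != 0 ->
    gamma D a y^-1%g y d = n d /\ (n d = 1 \/ n d = -1);
  P6 : forall d, distinguished a Delta d -> (d ^+ 2 = 1)%g;
  P7 : forall x y z, gamma D a x y z = gamma D a y z x;
  P8 : forall x y z, gamma D a x y z != 0 ->
    [/\ simL D x y^-1%g, simL D y z^-1%g & simL D z x^-1%g];
  P9 : forall z z', leL D z' z -> a z' = a z -> simL D z' z;
  P10 : forall z z', leR D z' z -> a z' = a z -> simR D z' z;
  P11 : forall z z', leLR D z' z -> a z' = a z -> simLR D z' z;
  P12 : forall I : set W, I `<=` S ->
    forall (D_I : hecke_datum [set s : parabolic I | I (val s)]
                              (fun w : parabolic I => L (val w)))
           (a_I : parabolic I -> nat),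
      is_a_function D_I a_I -> forall y, a_I y = a (val y);
  P13 : forall C, left_cell D C ->
    exists d, [/\ C d, distinguished a Delta d,
      forall d', C d' -> distinguished a Delta d' -> d' = d
      & forall x, C x -> gamma D a x^-1%g x d != 0];
  P14 : forall z, simLR D z z^-1%g;
  P15 : forall x x' y w, a w = a y ->
    \sum_(y' \in [set: W]) in_v' (hh D w x' y') * in_v (hh D x y' y) =
    \sum_(y' \in [set: W]) in_v (hh D x w y') * in_v' (hh D y' x' y)
}.

(** * Formal sums *)

(* The formal sum of the f(w) t_w is represented by f : W -> A^o, the A-module
   structure being the pointwise one. *)
Section FormalSums.
Variables (W : groupType) (S : set W) (L : W -> int) (D : hecke_datum S L).
Variables (a Delta : W -> nat) (n : W -> int) (A : comPzRingType).
Implicit Types (f g : W -> A^o) (P Q : set (W -> A^o)).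

Definition left_admissible : set (W -> A^o) :=
  [set f | forall C, left_cell D C -> finite_set ([set w | f w != 0] `&` C)].
Definition right_admissible : set (W -> A^o) :=
  [set f | forall C, right_cell D C -> finite_set ([set w | f w != 0] `&` C)].

Definition conv_term f g (z : W) (xy : W * W) : A :=
  f xy.1 * g xy.2 * (gamma D a xy.1 xy.2 z^-1%g)%:~R.

Definition conv_defined f g : Prop :=
  forall z, finite_set [set xy | conv_term f g z xy != 0].

(* only meaningful when [conv_defined f g] *)
Definition conv f g : W -> A^o :=
  fun z => \sum_(xy \in [set: W * W]) conv_term f g z xy.

Definition sum_n_t : W -> A^o :=
  fun d => if `[< distinguished a Delta d >] then (n d)%:~R else 0.

Definition is_submodule P : Prop :=
  P 0 /\ forall (b : A) f g, P f -> P g -> P (b *: f + g).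

(* P, with the pointwise module structure and the product conv, is an
   associative A-algebra with unit e. This is spelled out because the carrier
   of an [algType] is a nonzero ring, whereas A may be the zero ring. *)
Record is_unital_algebra P (e : W -> A^o) : Prop := {
  algebra_submodule : is_submodule P;
  algebra_conv : forall f g, P f -> P g -> P (conv f g);
  algebra_linear_l : forall (b : A) f f' g, P f -> P f' -> P g ->
    conv (b *: f + f') g = b *: conv f g + conv f' g;
  algebra_linear_r : forall (b : A) f g g', P f -> P g -> P g' ->
    conv f (b *: g + g') = b *: conv f g + conv f g';
  algebra_assoc : forall f g h, P f -> P g -> P h ->
    conv f (conv g h) = conv (conv f g) h;
  algebra_one : P e;
  algebra_mul1l : forall f, P f -> conv e f = f;
  algebra_mul1r : forall f, P f -> conv f e = f
}.

Definition is_subalgebra Q P : Prop :=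
  [/\ Q `<=` P, is_submodule Q & forall f g, Q f -> Q g -> Q (conv f g)].

Definition finitely_supported : set (W -> A^o) :=
  [set f | finite_set [set w | f w != 0]].

Definition t_ (w : W) : W -> A^o := fun z => (z == w)%:R.

(* the product of J_A: the bilinear extension of
   t_x t_y = \sum_z gamma_{x,y,z^-1} t_z *)
Definition J_mul f g : W -> A^o :=
  \sum_(x \in [set: W]) \sum_(y \in [set: W])
    (f x * g y) *:
      \sum_(z \in [set: W]) ((gamma D a x y z^-1%g)%:~R : A) *: t_ z.

End FormalSums.

(* Main.v *)
From HB Require Import structures.
Require Import Defs.
From mathcomp Require Import all_boot all_order all_algebra finmap perm.
From mathcomp Require Import boolp classical_sets functions cardinality fsbigop.
From mathcomp Require Import monalg.
Set Implicit Arguments.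
Unset Strict Implicit.
Unset Printing Implicit Defensive.
Import Order.TTheory GRing.Theory Num.Theory.
Local Open Scope classical_set_scope.
Local Open Scope ring_scope.

(** If gamma_{x,y,z^-1} <> 0, then P8 places y in the left cell of z and x in
    the left cell of y^-1; so for left admissible f, f' and for z in a fixed
    left cell, only finitely many (x, y) contribute to f''(z). Associativity is
    that of J, which is the coefficient of v'^a v^a in P15 (where a = a(z)),
    and P2, P3, P5, P7 say that the sum of the n_d t_d is a unit element.

    The right-handed statements are the left-handed ones for the opposite
    structure constants, once inversion is known to exchange left and right
    cells. For this, the anti-automorphism of H fixing the T_s commutes with the
    bar involution, hence sends c_w to c_{w^-1} because a bar-invariant element
    with coefficients in v^-1 Z[v^-1] vanishes. *)

(** * Convolution products *)

(** A sum over W has the value 0 by convention when its support is infinite, so each manipulation of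
    f'' rests on a finite list covering all contributing indices; for associativity one list must
    serve both bracketings.

    P8 and P13 speak of left cells, and their right-handed counterparts are obtained from the
    symmetry h_{x,y,z} = h_{y^-1,x^-1,z^-1}. Comparing coefficients there presupposes that the c_w
    are independent. [hecke_datum] records about the p_{y,w} only that p_{w,w} = 1 and that the
    others lie in v^-1 Z[v^-1], with no triangularity for an order on W, so independence is drawn
    from degrees in v. The vanishing of bar-invariant elements uses instead the filtration of H by
    length, for which the fact that l(sw) is l(w) + 1 or l(w) - 1 is recovered from the sign
    character of W. *)

Section FiniteSums.
Variables (T : choiceType) (V : nmodType).

Lemma finite_set_seq (X : set T) : finite_set X ->
  exists2 r : seq T, uniq r & forall x, X x -> x \in r.
Proof.
by move=> /finite_fsetP[F ->]; exists F => //; apply: fset_uniq.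
Qed.

(** A duplicate-free list covering the support excludes the default value 0 of an infinite sum and
    makes the theory of [bigop] available. *)
Lemma fsum_seq (r : seq T) (F : T -> V) : uniq r ->
  (forall x, F x <> 0 -> x \in r) ->
  \sum_(x \in [set: T]) F x = \sum_(x <- r) F x.
Proof.
move=> ur cov; rewrite (fsbigE r) //.
  by apply: eq_bigl => x; rewrite in_setT.
by move=> x _ /negP nx; apply: contrapT => Fx; apply: nx; apply: cov.
Qed.

End FiniteSums.

Section Convolution.
Variables (W : choiceType) (A : comPzRingType).
Implicit Types (c : W -> W -> W -> int) (f g h : W -> A^o).

Definition convolution c f g : W -> A^o :=
  fun z => \sum_(xy \in [set: W * W])
             (f xy.1 * g xy.2 * (c xy.1 xy.2 z)%:~R : A).

(** Reindexing by the swap of pairs; this is the passage to the opposite structure constants. *)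
Lemma convolutionC c f g :
  convolution (fun x y => c y x) f g = convolution c g f.
Proof.
apply/funext => z; rewrite /convolution.
rewrite (@reindex_fsbig _ _ _ _ _ (fun p : W * W => (p.2, p.1)) setT setT) /=.
  by apply: eq_fsbigr => p _; rewrite [g _ * f _]mulrC.
split=> [//|[x y] [x' y'] _ _ [-> ->]//|[x y] _].
by exists (y, x).
Qed.

Lemma intr_neq0 (m : int) : (m%:~R : A) <> 0 -> m != 0.
Proof. by move=> h; apply/eqP => m0; apply: h; rewrite m0. Qed.

Lemma term_neq0 (x y : A) (m : int) :
  x * y * m%:~R <> 0 -> [/\ x <> 0, y <> 0 & m != 0].
Proof.
move=> h; split; last apply: (@intr_neq0 m); move=> e; apply: h; rewrite e.
- by rewrite !mul0r.
- by rewrite mulr0 mul0r.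
- by rewrite mulr0.
Qed.

Lemma convolution_seq c f g z (r : seq W) : uniq r ->
  (forall x y, f x <> 0 -> g y <> 0 -> c x y z != 0 -> x \in r /\ y \in r) ->
  convolution c f g z =
  \sum_(x <- r) \sum_(y <- r) (f x * g y * (c x y z)%:~R : A).
Proof.
move=> ur cov; rewrite /convolution.
rewrite (@fsum_seq _ _ [seq (x, y) | x <- r, y <- r]); last 2 first.
- by rewrite allpairs_uniq // => -[x y] [x' y'] _ _ /= [-> ->].
- move=> [x y] /= /term_neq0[fx gy cz].
  by have [xr yr] := cov _ _ fx gy cz; apply/allpairsP; exists (x, y).
by rewrite big_allpairs.
Qed.

Lemma convolution_support c f g z : convolution c f g z <> 0 ->
  exists x y, [/\ f x <> 0, g y <> 0 & c x y z != 0].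
Proof.
move=> h; apply: contrapT => hN; apply: h; apply: fsbig1 => -[x y] _ /=.
apply: contrapT => /term_neq0[fx gy cz]; apply: hN.
by exists x, y.
Qed.

(** Both bracketings are expanded into the same triple sum over x, u, v, whose inner sums over y
    agree by associativity of the constants. The intermediate index y arises from (u, v) in one
    bracketing and from (x, u) in the other, hence the two covering hypotheses. *)
Lemma convolutionA c f g h z (r : seq W) : uniq r ->
  (forall x u v y, f x <> 0 -> g u <> 0 -> h v <> 0 ->
     c x y z != 0 -> c u v y != 0 -> [/\ x \in r, u \in r, v \in r & y \in r]) ->
  (forall x u v y, f x <> 0 -> g u <> 0 -> h v <> 0 ->
     c x u y != 0 -> c y v z != 0 -> [/\ x \in r, u \in r, v \in r & y \in r]) ->
  (forall x u v, \sum_(y \in [set: W]) c x y z * c u v y =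
                 \sum_(y \in [set: W]) c x u y * c y v z) ->
  convolution c f (convolution c g h) z = convolution c (convolution c f g) h z.
Proof.
move=> ur covl covr assoc.
transitivity (\sum_(x <- r) \sum_(u <- r) \sum_(v <- r)
   (f x * g u * h v * (\sum_(y <- r) c x y z * c u v y)%:~R)).
  rewrite (@convolution_seq _ _ _ _ r) //; last first.
    move=> x y fx /convolution_support[u [v [gu hv cy]]] cz.
    by have [] := covl x u v y fx gu hv cz cy.
  apply: eq_bigr => x _.
  transitivity (\sum_(y <- r) \sum_(u <- r) \sum_(v <- r)
      (f x * g u * h v * (c x y z * c u v y)%:~R)); last first.
    rewrite exchange_big; apply: eq_bigr => u _ /=.
    rewrite exchange_big; apply: eq_bigr => v _ /=.
    by rewrite rmorph_sum mulr_sumr.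
  apply: eq_bigr => y _.
  (* The list covers the inner convolution only for x and y that contribute to the outer one; the
     other terms vanish on both sides. *)
  have [fx0|/eqP fx] := eqVneq (f x) 0.
    rewrite fx0 !mul0r big1 // => u _; rewrite big1 // => v _.
    by rewrite !mul0r.
  have [cz0|cz] := eqVneq (c x y z) 0.
    rewrite cz0 mulr0 big1 // => u _; rewrite big1 // => v _.
    by rewrite mul0r mulr0.
  rewrite (@convolution_seq _ _ _ _ r) //; last first.
    by move=> u v gu hv cy; have [] := covl x u v y fx gu hv cz cy.
  rewrite mulr_sumr mulr_suml; apply: eq_bigr => u _.
  rewrite mulr_sumr mulr_suml; apply: eq_bigr => v _.
  by rewrite intrM [_%:~R * _]mulrC !mulrA.
transitivity (\sum_(x <- r) \sum_(u <- r) \sum_(v <- r)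
   (f x * g u * h v * (\sum_(y <- r) c x u y * c y v z)%:~R)).
  apply: eq_bigr => x _; apply: eq_bigr => u _; apply: eq_bigr => v _.
  have [->|/eqP fx] := eqVneq (f x) 0; first by rewrite !mul0r.
  have [->|/eqP gu] := eqVneq (g u) 0; first by rewrite mulr0 !mul0r.
  have [->|/eqP hv] := eqVneq (h v) 0; first by rewrite mulr0 !mul0r.
  congr (_ * _%:~R).
  rewrite -(fsum_seq (F := fun y => c x y z * c u v y) ur) ?assoc.
    apply: fsum_seq => // y /eqP; rewrite mulf_eq0 negb_or => /andP[c1 c2].
    by have [] := covr x u v y fx gu hv c1 c2.
  move=> y /eqP; rewrite mulf_eq0 negb_or => /andP[c1 c2].
  by have [] := covl x u v y fx gu hv c1 c2.
rewrite [RHS](@convolution_seq _ _ _ _ r) //; last first.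
  move=> y v /convolution_support[x [u [fx gu cy]]] hv cz.
  by have [] := covr x u v y fx gu hv cy cz.
transitivity (\sum_(y <- r) \sum_(v <- r) \sum_(x <- r) \sum_(u <- r)
    (f x * g u * h v * (c x u y * c y v z)%:~R)); last first.
  apply: eq_bigr => y _; apply: eq_bigr => v _.
  have [hv0|/eqP hv] := eqVneq (h v) 0.
    rewrite hv0 mulr0 mul0r big1 // => x _; rewrite big1 // => u _.
    by rewrite mulr0 mul0r.
  have [cz0|cz] := eqVneq (c y v z) 0.
    rewrite cz0 mulr0 big1 // => x _; rewrite big1 // => u _.
    by rewrite mulr0 mulr0.
  rewrite (@convolution_seq _ _ _ _ r) //; last first.
    by move=> x u fx gu cy; have [] := covr x u v y fx gu hv cy cz.
  rewrite !mulr_suml; apply: eq_bigr => x _.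
  rewrite !mulr_suml; apply: eq_bigr => u _.
  by rewrite intrM !mulrA; congr (_ * _); rewrite mulrAC.
under [RHS]eq_bigr do rewrite exchange_big /=.
rewrite [RHS]exchange_big; apply: eq_bigr => x _ /=.
under [RHS]eq_bigr do rewrite exchange_big /=.
rewrite [RHS]exchange_big; apply: eq_bigr => u _ /=.
rewrite [RHS]exchange_big; apply: eq_bigr => v _ /=.
by rewrite rmorph_sum mulr_sumr.
Qed.

Lemma linear_funE (b : A) f g x :
  (b *: f + g) x = (b : A) * (f x : A) + (g x : A) :> A.
Proof. by []. Qed.

Lemma convolution_linear_l c (b : A) f f' g z (r : seq W) : uniq r ->
  (forall x y, f x <> 0 \/ f' x <> 0 -> g y <> 0 -> c x y z != 0 ->
     x \in r /\ y \in r) ->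
  convolution c (b *: f + f') g z =
  (b *: convolution c f g + convolution c f' g) z.
Proof.
move=> ur cov; have split_neq0 x : (b *: f + f') x <> 0 -> f x <> 0 \/ f' x <> 0.
  move=> h; apply: contrapT => /not_orP[/contrapT f0 /contrapT f'0]; apply: h.
  by rewrite linear_funE f0 f'0 mulr0 addr0.
rewrite [RHS]linear_funE !(@convolution_seq _ _ _ _ r) //.
- rewrite mulr_sumr -big_split; apply: eq_bigr => x _ /=.
  rewrite mulr_sumr -big_split; apply: eq_bigr => y _ /=.
  by rewrite linear_funE !mulrDl !mulrA.
- by move=> x y f'x; apply: cov; right.
- by move=> x y fx; apply: cov; left.
- by move=> x y /split_neq0; apply: cov.
Qed.

(** Only the pair (d, z) can contribute to the coefficient at z, and it contributes f(z). *)
Lemma convolution_unit_l c (e : W -> A^o) :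
  (forall z, exists d, e d * (c d z z)%:~R = 1 :> A /\
     forall x y, e x <> 0 -> c x y z != 0 -> x = d /\ y = z) ->
  forall f, convolution c e f = f.
Proof.
move=> unit f; apply/funext => z; have [d [ed dz]] := unit z.
rewrite /convolution (@fsum_seq _ _ [:: (d, z)]) //.
  by rewrite big_seq1 /= mulrAC ed mul1r.
move=> [x y] /= /term_neq0[ex _ cz]; rewrite inE; apply/eqP.
by have [-> ->] := dz x y ex cz.
Qed.

End Convolution.

(* To be applied to left cells, to right cells with the opposite structure
   constants, and to the trivial relation, whose admissible functions are those
   of finite support. *)
Section Admissible.
Variables (W : choiceType) (A : comPzRingType).
Variables (c : W -> W -> W -> int) (E : W -> W -> Prop) (inv : W -> W).
Hypothesis Esym : forall x y, E x y -> E y x.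
Hypothesis Etrans : forall x y z, E x y -> E y z -> E x z.
Hypothesis c_fin : forall x y, finite_set [set z | c x y z != 0].
Hypothesis c_r : forall x y z, c x y z != 0 -> E y z.
Hypothesis c_l : forall x y z, c x y z != 0 -> E x (inv y).
Implicit Types (f g h : W -> A^o).

Definition admissible : set (W -> A^o) :=
  [set f | forall w, finite_set [set x | f x <> 0 /\ E x w]].

Lemma convolution_pairs_finite f g w : admissible f -> admissible g ->
  finite_set [set xy | [/\ f xy.1 <> 0, g xy.2 <> 0, E xy.2 w &
                           E xy.1 (inv xy.2)]].
Proof.
move=> af ag; pose Y := [set y | g y <> 0 /\ E y w].
have := @bigcup_finite _ _ Y
  (fun y => (fun x => (x, y)) @` [set x | f x <> 0 /\ E x (inv y)]) (ag w).
move=> H; apply: (sub_finite_set _ (H _)) => [[x y] /= [fx gy Ey Ex]|y _].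
  by exists y => //; exists x.
exact: finite_image.
Qed.

Lemma convolution_terms_finite f g z : admissible f -> admissible g ->
  finite_set [set xy | (f xy.1 * g xy.2 * (c xy.1 xy.2 z)%:~R : A) != 0].
Proof.
move=> af ag; apply: sub_finite_set (convolution_pairs_finite z af ag).
move=> [x y] /= /eqP /term_neq0[fx gy cz]; split=> //.
  exact: c_r cz.
exact: c_l cz.
Qed.

(** The finite set of contributing pairs depends on the class of z alone, and each pair reaches
    finitely many z by [c_fin]. *)
Lemma admissible_convolution f g : admissible f -> admissible g ->
  admissible (convolution c f g).
Proof.
move=> af ag w; have := @bigcup_finite _ _ _
  (fun xy => [set z | c xy.1 xy.2 z != 0]) (convolution_pairs_finite w af ag).
move=> H; apply: (sub_finite_set _ (H _)) => [z /= [cz zw]|xy _]; last exact: c_fin.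
have [x [y [fx gy cxyz]]] := convolution_support cz.
exists (x, y) => //=; split=> //; last exact: c_l cxyz.
exact: Etrans (c_r cxyz) zw.
Qed.

Lemma admissible_linear (b : A) f g : admissible f -> admissible g ->
  admissible (b *: f + g).
Proof.
move=> af ag w.
apply: sub_finite_set (_ : finite_set ([set x | f x <> 0 /\ E x w] `|`
   [set x | g x <> 0 /\ E x w])) => [x /= [h xw]|]; last by rewrite finite_setU.
apply: contrapT => /not_orP[/not_andP h1 /not_andP h2]; apply: h.
case: h1 => [/contrapT f0|//]; case: h2 => [/contrapT g0|//].

by rewrite linear_funE f0 g0 mulr0 addr0.
Qed.

Lemma admissible0 : admissible 0.
Proof. by move=> w; apply: (sub_finite_set _ (finite_set0 _)) => x []. Qed.

Lemma admissible_convolution_linear_l (b : A) f f' g :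
  admissible f -> admissible f' -> admissible g ->
  convolution c (b *: f + f') g = b *: convolution c f g + convolution c f' g.
Proof.
move=> af af' ag; apply/funext => z.
pose X := [set xy | [/\ f xy.1 <> 0, g xy.2 <> 0, E xy.2 z & E xy.1 (inv xy.2)]]
 `|` [set xy | [/\ f' xy.1 <> 0, g xy.2 <> 0, E xy.2 z & E xy.1 (inv xy.2)]].
have Xfin : finite_set X.
  by rewrite finite_setU; split; apply: convolution_pairs_finite.
have [r ur cov] : exists2 r : seq W, uniq r &
    forall x, (fst @` X `|` snd @` X) x -> x \in r.
  by apply: finite_set_seq; rewrite finite_setU; split; apply: finite_image.
apply: (@convolution_linear_l _ _ _ _ _ _ _ _ r) => // x y fx gy cz.
have Xxy : X (x, y).
  by case: fx => fx; [left|right]; split=> //;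
    do ?[exact: (c_r cz)|exact: (c_l cz)].
by split; apply: cov; [left|right]; exists (x, y).
Qed.

(** Linearity on the left for the flipped constants. The relation [E] is not flipped with them, so
    the finite cover is built again. *)
Lemma admissible_convolution_linear_r (b : A) f g g' :
  admissible f -> admissible g -> admissible g' ->
  convolution c f (b *: g + g') = b *: convolution c f g + convolution c f g'.
Proof.
move=> af ag ag'; rewrite -!(convolutionC c _ f); apply/funext => z.
pose X := [set xy | [/\ f xy.1 <> 0, g xy.2 <> 0, E xy.2 z & E xy.1 (inv xy.2)]]
 `|` [set xy | [/\ f xy.1 <> 0, g' xy.2 <> 0, E xy.2 z & E xy.1 (inv xy.2)]].
have Xfin : finite_set X.
  by rewrite finite_setU; split; apply: convolution_pairs_finite.
have [r ur cov] : exists2 r : seq W, uniq r &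
    forall x, (fst @` X `|` snd @` X) x -> x \in r.
  by apply: finite_set_seq; rewrite finite_setU; split; apply: finite_image.
apply: (@convolution_linear_l _ _ _ _ _ _ _ _ r) => // y x gy fx cz.
have Xxy : X (x, y).
  by case: gy => gy; [left|right]; split=> //;
    do ?[exact: (c_r cz)|exact: (c_l cz)].
by split; apply: cov; [right|left]; exists (x, y).
Qed.

Lemma admissible_convolutionA f g h :
  (forall x u v z, \sum_(y \in [set: W]) c x y z * c u v y =
                   \sum_(y \in [set: W]) c x u y * c y v z) ->
  admissible f -> admissible g -> admissible h ->
  convolution c f (convolution c g h) = convolution c (convolution c f g) h.
Proof.
move=> assoc af ag ah; apply/funext => z.
(* The pair (u, v) lies in [UV] for both bracketings: v ~ y ~ z and u ~ inv v when (u, v) yields y,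
   while v ~ z and u ~ y ~ inv v when (x, u) yields y. Then x is confined to the class of inv y in
   the one case and of inv u in the other. *)
pose UV := [set uv | [/\ g uv.1 <> 0, h uv.2 <> 0, E uv.2 z &
                         E uv.1 (inv uv.2)]].
have UVfin : finite_set UV by apply: convolution_pairs_finite.
pose Y := \bigcup_(uv in UV) [set y | c uv.1 uv.2 y != 0].
have Yfin : finite_set Y by apply: bigcup_finite => // uv _; apply: c_fin.
pose X := \bigcup_(y in Y) [set x | f x <> 0 /\ E x (inv y)].
have Xfin : finite_set X by apply: bigcup_finite => // y _; apply: af.
pose X' := \bigcup_(uv in UV) [set x | f x <> 0 /\ E x (inv uv.1)].
have X'fin : finite_set X' by apply: bigcup_finite => // uv _; apply: af.
pose Y' := \bigcup_(x in X') \bigcup_(uv in UV) [set y | c x uv.1 y != 0].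
have Y'fin : finite_set Y'.
  by do 2![apply: bigcup_finite => // ? _]; apply: c_fin.
have [r ur cov] : exists2 r : seq W, uniq r &
    forall x, ((fst @` UV `|` snd @` UV) `|` (X `|` Y `|` (X' `|` Y'))) x -> x \in r.
  by apply: finite_set_seq; rewrite !finite_setU; split; [split; exact: finite_image|].
apply: (@convolutionA _ _ _ _ _ _ _ r) => // x u v y fx gu hv c1 c2.
- have UVuv : UV (u, v).
    split=> //=; last exact: c_l c2.
    exact: Etrans (c_r c2) (c_r c1).
  have Yy : Y y by exists (u, v).
  split; apply: cov.
  + by right; left; left; exists y => //; split=> //; apply: c_l c1.
  + by left; left; exists (u, v).
  + by left; right; exists (u, v).
  + by right; left; right.
- have UVuv : UV (u, v).
    split=> //=; first exact: c_r c2.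
    exact: Etrans (c_r c1) (c_l c2).
  have Xx : X' x by exists (u, v) => //; split=> //; apply: c_l c1.
  split; apply: cov.
  + by right; right; left.
  + by left; left; exists (u, v).
  + by left; right; exists (u, v).
  + by right; right; right; exists x => //; exists (u, v).
Qed.

End Admissible.

(** * The asymptotic ring J *)

Section Laurent.
Variable R : comNzRingType.
Implicit Types (f g : laurent R) (k : int).

Lemma lcoefD f g k : lcoef (f + g) k = lcoef f k + lcoef g k.
Proof. exact: mcoeffD. Qed.

Lemma lcoef0 k : lcoef (0 : laurent R) k = 0.
Proof. exact: mcoeff0. Qed.

Lemma lcoef_sum (I : Type) (r : seq I) (F : I -> laurent R) k :
  lcoef (\sum_(i <- r) F i) k = \sum_(i <- r) lcoef (F i) k.
Proof. exact: (big_morph _ (fun f g => lcoefD f g k) (lcoef0 k)). Qed.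

Lemma lcoefN f k : lcoef (- f) k = - lcoef f k.
Proof. by apply/eqP; rewrite -addr_eq0 -lcoefD addNr lcoef0. Qed.

Lemma lcoefU (c : R) i k : lcoef (lmono c i) k = if i == k then c else 0.
Proof. by rewrite /lcoef mcoeffU; case: eqP. Qed.

Lemma laurentP f g : (forall k, lcoef f k = lcoef g k) -> f = g.
Proof. by move=> h; apply/malgP. Qed.

Lemma lmonoM (a b : R) i j : lmono a i * lmono b j = lmono (a * b) (i + j).
Proof. exact: lmulUU. Qed.

Lemma lcoefM f g k : lcoef (f * g) k =
  \sum_(i <- msupp f) \sum_(j <- msupp g)
    if i + j == k then lcoef f i * lcoef g j else 0.
Proof.
rewrite lcoef_sum; apply: eq_bigr => i _.
by rewrite lcoef_sum; apply: eq_bigr => j _; rewrite lcoefU.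
Qed.

Lemma lcoef_supp f k : lcoef f k != 0 -> k \in msupp f.
Proof. by rewrite /lcoef mcoeff_neq0. Qed.

Lemma msupp_lcoef f k : k \in msupp f -> lcoef f k != 0.
Proof. by rewrite /lcoef mcoeff_neq0. Qed.

(** The substitution of v^-1 for v, which is the bar involution on scalars. *)
Definition lrev f : laurent R := \sum_(i <- msupp f) lmono (lcoef f i) (- i).

Lemma lcoef_lrev f k : lcoef (lrev f) k = lcoef f (- k).
Proof.
rewrite /lrev lcoef_sum.
have [k0|k0] := eqVneq (lcoef f (- k)) 0.
  rewrite big1_seq // => i _; rewrite lcoefU.
  by case: eqP => // ik; move: k0; rewrite -ik opprK => ->.
rewrite (bigD1_seq (- k)) ?lcoef_supp ?fset_uniq //= lcoefU opprK eqxx.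
rewrite big1 ?addr0 // => i ik; rewrite lcoefU.
by case: eqP => // e; rewrite -e opprK eqxx in ik.
Qed.

End Laurent.

Section LaurentZ.
Implicit Types (x y : Zv) (m n : int).

Lemma deg_leM m n x y : deg_le m x -> deg_le n y -> deg_le (m + n) (x * y).
Proof.
move=> hx hy k lt; rewrite lcoefM big1_seq // => i /= ix.
rewrite big1_seq // => j /= jy; case: eqP => // e.
have im : i <= m.
  by rewrite leNgt; apply/negP => /hx /eqP; apply/negP/msupp_lcoef.
have jn : j <= n.
  by rewrite leNgt; apply/negP => /hy /eqP; apply/negP/msupp_lcoef.
by move: lt; rewrite -e ltNge lerD.
Qed.

Lemma deg_le_exists x : exists N : int, deg_le N x.
Proof.
exists (\sum_(i <- msupp x) `|i|) => k lt; apply/eqP; apply: contraTT lt.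
move=> /lcoef_supp kx; rewrite -leNgt (big_rem k) //=.
by rewrite (le_trans (ler_norm k)) // lerDl sumr_ge0.
Qed.

Lemma lcoef_intM m x k : lcoef (m%:~R * x) k = m * lcoef x k.
Proof.
rewrite mulrzl mulrC -mulrzz; elim/int_rect: m => [|m IH|m IH].
- by rewrite mulr0z lcoef0 mulr0z.
- by rewrite !intS !mulrzDr !mulr1z lcoefD IH.
- by rewrite intS opprD !mulrzDr !mulrN1z lcoefD lcoefN IH.
Qed.

Lemma lcoef2_sum (I : Type) (r : seq I) (F : I -> laurent Zv) k l :
  lcoef (lcoef (\sum_(i <- r) F i) k) l =
  \sum_(i <- r) lcoef (lcoef (F i) k) l.
Proof. by rewrite (lcoef_sum r F) (lcoef_sum r (fun i => lcoef (F i) k)). Qed.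

(** The coefficient of v'^k v^l: the exponent of v' is read first, then that of v. *)
Lemma lcoef_in_v'_in_v x y k l :
  lcoef (lcoef (in_v' x * in_v y) k) l = lcoef x k * lcoef y l.
Proof.
have -> : lcoef (in_v' x * in_v y) k = (lcoef x k)%:~R * y.
  rewrite /in_v' mulr_suml lcoef_sum.
  have [k0|k0] := eqVneq (lcoef x k) 0.
    rewrite big1_seq ?k0 ?mul0r // => i _; rewrite lmonoM lcoefU addr0.
    by case: eqP => // ->; rewrite k0 mul0r.
  rewrite (bigD1_seq k) ?lcoef_supp ?fset_uniq //= lmonoM lcoefU addr0 eqxx.
  rewrite big1 ?addr0 // => i ik; rewrite lmonoM lcoefU addr0.
  by case: eqP => // e; rewrite e eqxx in ik.
exact: lcoef_intM.
Qed.

End LaurentZ.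

(** * The structure constants of J *)

Section AsymptoticRing.
Variables (W : groupType) (S : set W) (L : W -> int) (D : hecke_datum S L).
Variables (a Delta : W -> nat) (n : W -> int).
Hypothesis P : P1_to_P15 D a Delta n.

(** The coefficient of t_z in t_x t_y; the inversion built into the third index of [gamma] is
    undone. *)
Definition J_coef (x y z : W) : int := gamma D a x y z^-1%g.

Lemma J_coefE x y z : J_coef x y z = lcoef (hh D x y z) (a z)%:Z.
Proof. by rewrite /J_coef /gamma invgK. Qed.

Lemma hh_neq0 x y z : J_coef x y z != 0 -> hh D x y z != 0.
Proof. by rewrite J_coefE; apply: contraNneq => ->; rewrite lcoef0. Qed.

Lemma J_coef_finite x y : finite_set [set z | J_coef x y z != 0].
Proof. by apply: (sub_finite_set _ (@hh_finite _ _ _ D x y)) => z; apply: hh_neq0. Qed.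

Lemma leL_leLR x y : leL D x y -> leLR D x y.
Proof.
move=> xy; elim: xy => [u v uv|u|u v w _ uv _ vw].
- by apply: Relation_Operators.rt_step; left.
- exact: Relation_Operators.rt_refl.
- exact: Relation_Operators.rt_trans uv vw.
Qed.

Lemma a_simL x y : simL D x y -> a x = a y.
Proof.
by move=> [xy yx]; apply/eqP; rewrite eqn_leq !(P4 P) //; apply: leL_leLR.
Qed.

Lemma a_inv x : a x^-1%g = a x.
Proof.
by have [xy yx] := P14 P x; apply/eqP; rewrite eqn_leq !(P4 P).
Qed.

Lemma J_coef_simL x y z : J_coef x y z != 0 ->
  [/\ simL D x y^-1%g, simL D y z & simL D z^-1%g x^-1%g].
Proof. by move=> /(P8 P); rewrite invgK. Qed.

Lemma J_coef_a x y z : J_coef x y z != 0 -> a x = a z /\ a y = a z.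
Proof.
move=> /J_coef_simL[/a_simL xy /a_simL yz _]; split => //.
by rewrite xy a_inv.
Qed.

Lemma J_coefA x u v z : \sum_(y \in [set: W]) J_coef x y z * J_coef u v y =
                        \sum_(y \in [set: W]) J_coef x u y * J_coef y v z.
Proof.
(* P15 is available only if a(u) = a(z). A nonzero term on either side forces this equality, by way
   of a(y), so otherwise both sums vanish. *)
have [uz|/eqP uz] := eqVneq (a u) (a z); last first.
  rewrite !fsbig1 // => y _; apply/eqP; rewrite mulf_eq0;
    case: eqVneq => //= h1; apply: contrapT => /negP h2; apply: uz.
  - by have [<- _] := J_coef_a h2; have [_ <-] := J_coef_a h1.
  - by have [_ <-] := J_coef_a h1; have [<- _] := J_coef_a h2.
have [r1 u1 c1] := finite_set_seq (@hh_finite _ _ _ D u v).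
have [r2 u2 c2] := finite_set_seq (@hh_finite _ _ _ D x u).
pose F1 y : laurent Zv := in_v' (hh D u v y) * in_v (hh D x y z).
pose F2 y : laurent Zv := in_v (hh D x u y) * in_v' (hh D y v z).
have E1 : \sum_(y \in [set: W]) F1 y = \sum_(y <- r1) F1 y.
  apply: fsum_seq => // y h; apply: c1; apply/eqP => h0; apply: h.
  by rewrite /F1 h0 /in_v' msupp0 big_seq_fset0 mul0r.
have E2 : \sum_(y \in [set: W]) F2 y = \sum_(y <- r2) F2 y.
  apply: fsum_seq => // y h; apply: c2; apply/eqP => h0; apply: h.
  by rewrite /F2 h0 /in_v /lmono monalgU0 mul0r.
have E : \sum_(y <- r1) F1 y = \sum_(y <- r2) F2 y.
  by rewrite -E1 -E2; exact: (P15 P x v uz).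
have e := etrans (esym (lcoef2_sum r1 F1 (a z) (a z)))
  (etrans (congr1 (fun F => lcoef (lcoef F (a z)) (a z)) E)
          (lcoef2_sum r2 F2 (a z) (a z))).
have -> : \sum_(y \in [set: W]) J_coef x y z * J_coef u v y =
          \sum_(y <- r1) J_coef x y z * J_coef u v y.
  apply: fsum_seq; [by []|move=> y /eqP];
    rewrite mulf_eq0 negb_or => /andP[_ /hh_neq0]; exact: c1.
have -> : \sum_(y \in [set: W]) J_coef x u y * J_coef y v z =
          \sum_(y <- r2) J_coef x u y * J_coef y v z.
  apply: fsum_seq; [by []|move=> y /eqP];
    rewrite mulf_eq0 negb_or => /andP[/hh_neq0 h _]; exact: c2.
transitivity (\sum_(i <- r1)
  lcoef (lcoef (F1 i) (a z)) (a z)).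
  (* The exponent is a(z) in both variables, whereas [J_coef] reads h_{u,v,y} at a(y). The two agree
     whenever the other factor is nonzero. *)
  apply: eq_bigr => y _; rewrite /F1 lcoef_in_v'_in_v -J_coefE.
  have [->|h] := eqVneq (J_coef x y z) 0; first by rewrite mul0r mulr0.
  by have [_ yz] := J_coef_a h; rewrite -yz -J_coefE mulrC.
rewrite e; apply: eq_bigr => y _.
rewrite /F2 [in_v _ * _]mulrC lcoef_in_v'_in_v -J_coefE.
have [->|h] := eqVneq (J_coef y v z) 0; first by rewrite mul0r mulr0.
by have [yz _] := J_coef_a h; rewrite -yz -J_coefE mulrC.
Qed.

End AsymptoticRing.

(** * Words and lengths *)

Section Words.
Variables (W : groupType) (S : set W).
Hypothesis cox : coxeter_system S.
Implicit Types (w : W) (ws : seq W).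
Local Open Scope group_scope.

Local Notation wprod ws := (\prod_(s <- ws) s)%g.

Lemma gen_sq s : S s -> s * s = 1.
Proof. by case: cox => _ + _ _ => /[apply] -[_]; rewrite expg2. Qed.

Lemma gen_inv s : S s -> s^-1 = s.
Proof. by move=> /gen_sq h; rewrite -[LHS]mulg1 -h mulKg. Qed.

Lemma word_cons s ws : word S (s :: ws) <-> S s /\ word S ws.
Proof.
split=> [h|[Ss h] t].
  by split=> [|t tws]; apply: h; rewrite inE ?eqxx // tws orbT.
by rewrite inE => /orP[/eqP ->|/h].
Qed.

Lemma word_cat ws ws' : word S ws -> word S ws' -> word S (ws ++ ws').
Proof. by move=> h h' t; rewrite mem_cat => /orP[/h|/h']. Qed.

Lemma word_rev ws : word S ws -> word S (rev ws).
Proof. by move=> h t; rewrite mem_rev => /h. Qed.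

Lemma prod_cat ws ws' : wprod (ws ++ ws') = wprod ws * wprod ws'.
Proof.
elim: ws => [|s ws IH]; first by rewrite big_nil mul1g.
by rewrite cat_cons !big_cons IH mulgA.
Qed.

Lemma prod_rev ws : word S ws -> wprod (rev ws) = (wprod ws)^-1.
Proof.
elim: ws => [|s ws IH]; first by rewrite big_nil invg1.
move=> /word_cons[Ss /IH e].
by rewrite rev_cons -cats1 prod_cat e !big_cons big_nil mulg1 invgM (gen_inv Ss).
Qed.

Lemma word_exists w : exists ws, word S ws /\ wprod ws = w.
Proof.
have [_ _ /(_ w) + _] := cox;
  elim => [s Ss||x y _ [ws [h1 h2]] _ [ws' [h1' h2']]|x _ [ws [h1 h2]]].
- by exists [:: s]; split; [apply/word_cons; split|rewrite big_seq1].
- by exists [::]; split=> //; rewrite big_nil.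
- by exists (ws ++ ws'); split; [apply: word_cat|rewrite prod_cat h2 h2'].
- by exists (rev ws); split; [apply: word_rev|rewrite prod_rev // h2].
Qed.

(** Since S generates W, some word represents w, so the default value in [len] never occurs. *)
Lemma len_spec w : (exists ws, [/\ word S ws, wprod ws = w & size ws = len S w])
  /\ (forall ws, word S ws -> wprod ws = w -> (len S w <= size ws)%N).
Proof.
pose p n := `[< exists ws, [/\ word S ws, wprod ws = w & size ws = n] >].
have exp : exists n, p n.
  have [ws [h1 h2]] := word_exists w.
  by exists (size ws); apply/asboolP; exists ws.
have [m /asboolP pm min] := ex_minnP exp.
rewrite /len; set X := (X in xget _ X); apply: (xgetPex 0%N (P := X)).
by exists m; split=> // ws h1 h2; apply: min; apply/asboolP; exists ws.
Qed.

Lemma reduced_exists w : exists2 ws, reduced S ws & wprod ws = w.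
Proof. by have [[ws [h1 h2 h3]] _] := len_spec w; exists ws; rewrite // /reduced h2. Qed.

Lemma len_prod ws : word S ws -> (len S (wprod ws) <= size ws)%N.
Proof. by move=> h; have [_] := len_spec (wprod ws); apply. Qed.

Lemma len1 : len S 1 = 0%N.
Proof. by have := @len_prod [::]; rewrite big_nil leqn0 => /(_ _)/eqP; apply. Qed.

Lemma reduced_rev ws : reduced S ws -> reduced S (rev ws).
Proof.
have le w : (len S w^-1 <= len S w)%N.
  have [vs [h1 h2] <-] := reduced_exists w.
  by rewrite -h2 -prod_rev // -size_rev len_prod //; apply: word_rev.
move=> [h1 h2]; split; first exact: word_rev.
rewrite size_rev prod_rev // h2; apply/eqP; rewrite eqn_leq le.
by rewrite -{1}(invgK (wprod ws)) le.
Qed.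

(** The sign character, with the group of order two realised as [{perm bool}]. The relations hold
    because the product of two images is already 1. *)
Lemma sign_exists : exists g : {multiplicative W -> {perm bool}},
  forall s, S s -> g s = tperm true false.
Proof.
have [_ _ _ /(_ _ (fun=> tperm true false))] := cox; apply => s t m _ _ _.
by rewrite tperm2 expg1n.
Qed.

Lemma len_parity ws : word S ws -> odd (size ws) = odd (len S (wprod ws)).
Proof.
have [g gS] := sign_exists.
have g1 : g 1 = 1 by apply: (@mulgI _ (g 1)); rewrite -gmulfM !mulg1.
have sgn vs : word S vs -> g (wprod vs) = tperm true false ^+ odd (size vs).
  elim: vs => [|s vs IH]; first by rewrite big_nil g1.
  move=> /word_cons[Ss /IH e]; rewrite big_cons gmulfM e (gS _ Ss) /=.
  by case: (odd _); rewrite ?expg1 ?mulg1 ?tperm2.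
move=> h; have [vs [h1 h2] h3] := reduced_exists (wprod ws).
have := sgn _ h; rewrite -h3 -h2 (sgn _ h1).
have ne : tperm true false != 1 :> {perm bool}.
  by apply/eqP => /(congr1 (fun p : {perm bool} => p true)); rewrite tpermL perm1.
have tE (b : bool) : (tperm true false ^+ b == 1 :> {perm bool}) = ~~ b.
  by case: b; rewrite ?expg1 ?expg0 ?eqxx // (negbTE ne).
case: (odd (size ws)) (odd (size vs)) => -[] //.
  by move/esym/eqP; rewrite tE.
by move/eqP; rewrite tE.
Qed.

(** Multiplying by s changes the length by at most one in either direction, and the sign character
    excludes equality. *)
Lemma len_gen_mul s w : S s ->
  len S (s * w) = (len S w).+1 \/ len S w = (len S (s * w)).+1.
Proof.
move=> Ss; have le x : (len S (s * x) <= (len S x).+1)%N.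
  have [ws [h1 h2] <-] := reduced_exists x.
  rewrite -h2; have := @len_prod (s :: ws); rewrite big_cons; apply.
  exact/word_cons.
have le1 := le w; have := le (s * w); rewrite mulgA gen_sq // mul1g => le2.
have : odd (len S (s * w)) = ~~ odd (len S w).
  have [ws [h1 h2] <-] := reduced_exists w.
  rewrite -h2; have := @len_parity (s :: ws); rewrite big_cons /= => <- //.
  exact/word_cons.
move: le1 le2; rewrite leq_eqVlt => /orP[/eqP ->|]; first by left.
rewrite ltnS leq_eqVlt => /orP[/eqP ->|lt1 le2 _]; first by case: odd.
by right; apply/eqP; rewrite eqn_leq le2.
Qed.

End Words.

(** * The Hecke algebra *)

Section OppositeAlgebra.
Variables (R : comNzRingType) (B : algType R).

(** An algebra morphism into this copy of [B] is an anti-morphism into [B]; the universal property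
    of H can therefore produce one. *)
Definition opp_algebra : Type := B.
HB.instance Definition _ := GRing.Lmodule.copy opp_algebra B.

Definition opp_mul (x y : opp_algebra) : opp_algebra := (y : B) * (x : B).

Lemma opp_mulA : associative opp_mul.
Proof. by move=> x y z; rewrite /opp_mul mulrA. Qed.
Lemma opp_mul1l : left_id (1 : B) opp_mul.
Proof. exact: (@mulr1 B). Qed.
Lemma opp_mul1r : right_id (1 : B) opp_mul.
Proof. exact: (@mul1r B). Qed.
Lemma opp_mulDl : left_distributive opp_mul +%R.
Proof. by move=> x y z; exact: (@mulrDr B). Qed.
Lemma opp_mulDr : right_distributive opp_mul +%R.
Proof. by move=> x y z; exact: (@mulrDl B). Qed.
Lemma opp_one_neq0 : (1 : B) != 0 :> opp_algebra.
Proof. exact: (@oner_neq0 B). Qed.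

HB.instance Definition _ := GRing.Zmodule_isNzRing.Build opp_algebra
  opp_mulA opp_mul1l opp_mul1r opp_mulDl opp_mulDr opp_one_neq0.

Lemma opp_scaleAl (k : R) (x y : opp_algebra) : k *: opp_mul x y = opp_mul (k *: x) y.
Proof. exact: (@scalerAr R B k y x). Qed.
HB.instance Definition _ :=
  GRing.Lmodule_isLalgebra.Build R opp_algebra opp_scaleAl.

Lemma opp_scaleAr (k : R) (x y : opp_algebra) : k *: opp_mul x y = opp_mul x (k *: y).
Proof. exact: (@scalerAl R B k y x). Qed.
HB.instance Definition _ :=
  GRing.Lalgebra_isAlgebra.Build R opp_algebra opp_scaleAr.

End OppositeAlgebra.

Lemma altprodSl (B : algType Zv) (x y : B) m :
  altprod x y m.+1 = x * altprod y x m.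
Proof.
by rewrite /altprod big_ord_recl; congr (_ * _); apply: eq_bigr => i _ /=; case: odd.
Qed.

Lemma altprodSr (B : algType Zv) (x y : B) m :
  altprod x y m.+1 = altprod x y m * (if odd m then y else x).
Proof. by rewrite /altprod big_ord_recr. Qed.

(** Reversal fixes an alternating product of odd length and exchanges the two letters in one of even
    length. Either way a braid relation reverses to a braid relation. *)
Lemma altprod_opp (B : algType Zv) (x y : B) m :
  altprod (x : opp_algebra B) y m =
  if odd m then altprod x y m else altprod y x m.
Proof.
elim: m x y => [|m IH] x y; first by rewrite /altprod !big_ord0.
rewrite altprodSl IH [LHS]/(_ * x) /= !altprodSr.
by case: (odd m).
Qed.

(** * Coordinates with respect to a basis *)

Section BasisCoordinates.
Variables (W : groupType) (B : algType Zv) (b : W -> B).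
Hypothesis bB : is_basis b.
Implicit Types (x y : B) (r : seq W) (u : W -> Zv).

Definition bcoord x : W -> Zv := sval (cid (bB x)).

Lemma lincomb_seq u r : uniq r -> (forall w, u w != 0 -> w \in r) ->
  \sum_(w \in [set: W]) u w *: b w = \sum_(w <- r) u w *: b w.
Proof.
move=> ur cov; apply: fsum_seq => // w h; apply: cov.
by apply/eqP => u0; apply: h; rewrite u0 scale0r.
Qed.

Lemma bcoord_support x : exists2 r, uniq r & forall w, bcoord x w != 0 -> w \in r.
Proof.
by rewrite /bcoord; case: cid => u /= [[fu _] _]; apply: finite_set_seq fu.
Qed.

Lemma bcoordE x r : uniq r -> (forall w, bcoord x w != 0 -> w \in r) ->
  x = \sum_(w <- r) bcoord x w *: b w.
Proof.
move=> ur cov; rewrite -lincomb_seq //.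
by rewrite /bcoord; case: cid => u /= [[_ ->]].
Qed.

Lemma bcoord_unique x u r : uniq r -> (forall w, u w != 0 -> w \in r) ->
  x = \sum_(w <- r) u w *: b w -> bcoord x = u.
Proof.
move=> ur cov e; rewrite /bcoord; case: cid => u' /= [_]; apply; split.
  apply: sub_finite_set (_ : finite_set [set` r]) => // w; exact: cov.
by rewrite (lincomb_seq ur cov).
Qed.

Lemma bcoord_linear (k : Zv) x y w :
  bcoord (k *: x + y) w = k * bcoord x w + bcoord y w.
Proof.
have [r1 u1 c1] := bcoord_support x; have [r2 u2 c2] := bcoord_support y.
pose r := undup (r1 ++ r2); have ur : uniq r by apply: undup_uniq.
have cx w' : bcoord x w' != 0 -> w' \in r.
  by rewrite mem_undup mem_cat => /c1 ->.
have cy w' : bcoord y w' != 0 -> w' \in r.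
  by rewrite mem_undup mem_cat => /c2 ->; rewrite orbT.
rewrite (@bcoord_unique _ (fun w => k * bcoord x w + bcoord y w) r) // => [w' h|].
  have [x0|/cx //] := eqVneq (bcoord x w') 0; apply: cy.
  by move: h; rewrite x0 mulr0 add0r.
rewrite {1}(bcoordE ur cx) {1}(bcoordE ur cy) scaler_sumr -big_split.
by apply: eq_bigr => w' _; rewrite scalerDl scalerA.
Qed.

Lemma bcoordD x y w : bcoord (x + y) w = bcoord x w + bcoord y w.
Proof. by rewrite -[x]scale1r bcoord_linear mul1r scale1r. Qed.

Lemma bcoord0 w : bcoord 0 w = 0.
Proof. by apply: (addrI (bcoord 0 w)); rewrite -bcoordD !addr0. Qed.

Lemma bcoordZ (k : Zv) x w : bcoord (k *: x) w = k * bcoord x w.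
Proof. by rewrite -[_ *: _]addr0 bcoord_linear bcoord0 addr0. Qed.

Lemma bcoordN x w : bcoord (- x) w = - bcoord x w.
Proof. by rewrite -scaleN1r bcoordZ mulN1r. Qed.

Lemma bcoord_sum (I : Type) (r : seq I) (F : I -> B) w :
  bcoord (\sum_(i <- r) F i) w = \sum_(i <- r) bcoord (F i) w.
Proof. exact: (big_morph (fun x => bcoord x w) (fun x y => bcoordD x y w) (bcoord0 w)). Qed.

Lemma bcoord_basis v w : bcoord (b v) w = (w == v)%:R.
Proof.
rewrite (@bcoord_unique _ (fun w => (w == v)%:R) [:: v]) //.
  by move=> w'; rewrite inE; case: (w' == v); rewrite ?eqxx.
by rewrite big_seq1 eqxx scale1r.
Qed.

Lemma bcoord_eq0 x : (forall w, bcoord x w = 0) -> x = 0.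
Proof.
by move=> h; rewrite (@bcoordE x [::]) ?big_nil // => w; rewrite h eqxx.
Qed.

End BasisCoordinates.

Lemma vpowD i j : vpow (i + j) = vpow i * vpow j.
Proof. by rewrite /vpow lmonoM mulr1. Qed.

Lemma vpow0 : vpow 0 = 1.
Proof. by []. Qed.

Lemma lmonoE (c : int) k : lmono c k = c%:~R * vpow k :> Zv.
Proof.
apply: laurentP => l; rewrite lcoef_intM !lcoefU.
by case: eqP; rewrite ?mulr1 ?mulr0.
Qed.

(** * Triangularity of the bar involution with respect to length *)

Section Hecke.
Variables (W : groupType) (S : set W) (L : W -> int) (D : hecke_datum S L).
Hypothesis cox : coxeter_system S.

Local Notation T := (hT D).
Local Notation bar := (hbar D).
Local Notation tc := (bcoord (@hT_basis W S L D)).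
Local Notation len := (len S).

Lemma hT1 : T 1%g = 1.
Proof.
have := @hT_reduced _ _ _ D [::]; rewrite !big_nil; apply; split=> //.
by rewrite big_nil (len1 cox).
Qed.

Lemma hT_gen_mul s w : S s -> len (s * w)%g = (len w).+1 ->
  T (s * w)%g = T s * T w.
Proof.
move=> Ss lsw; have [ws [h1 h2] h3] := reduced_exists cox w.
rewrite -h3.
have := @hT_reduced _ _ _ D (s :: ws); rewrite !big_cons.
rewrite (hT_reduced D (conj h1 h2)); apply; split; first exact/word_cons.
by rewrite big_cons h3 lsw /= h2 h3.
Qed.

Definition xi s : Zv := vpow (L s) - vpow (- L s).

Lemma hT_gen_sqr s : S s -> T s * T s = xi s *: T s + 1.
Proof.
move=> Ss; have [[quad _] _] := hT_presentation D.
have := quad s Ss; rewrite mulrDr !mulrBl -!scalerAl -!scalerAr !mul1r !mulr1.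
rewrite scalerA -vpowD subrr vpow0 scale1r => /eqP.
rewrite addrA subr_eq0 => /eqP <-; rewrite scalerBl addrC addrA.
by rewrite subrK addrC subrK.
Qed.

Lemma hbar_gen s : S s -> bar (T s) = T s - xi s *: 1.
Proof.
move=> Ss; have [_ inv] := hbar_T D Ss.
rewrite -[RHS]mul1r -[X in X * _]inv -mulrA mulrBr hT_gen_sqr // -scalerAr.
by rewrite mulr1 addrAC subrr add0r mulr1.
Qed.

Lemma hbar_vpow k : bar (vpow k *: 1) = vpow (- k) *: 1.
Proof.
have pos (m : nat) : bar (vpow m *: 1) = vpow (- m%:Z) *: 1.
  elim: m => [|m IH]; first by rewrite oppr0 vpow0 scale1r rmorph1.
  rewrite intS opprD !vpowD -!scalerA -[X in vpow 1 *: X]mul1r scalerAl.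
  by rewrite rmorphM hbar_v IH -scalerAl mul1r.
case: (intP k) => [|m|m]; [exact: pos 0%N|exact: pos|].
by rewrite opprK -[RHS]hbar_involutive pos.
Qed.

(** [hbar] is only given as a ring morphism with a prescribed value at v, so semilinearity is
    obtained by writing scalars as multiples of 1 in H. *)
Lemma hbarZ (x : Zv) h : bar (x *: h) = lrev x *: bar h.
Proof.
have -> : x *: h = (x *: 1) * h by rewrite -scalerAl mul1r.
rewrite rmorphM -[lrev x *: _]mul1r -scalerAr scalerAl; congr (_ * _).
rewrite {1}[x]lsum /lrev !scaler_suml rmorph_sum; apply: eq_bigr => k _.
rewrite !lmonoE -!scalerA !scaler_int rmorphMz; congr (_ *~ _).
exact: hbar_vpow.
Qed.

(** Membership in the span of the T_w with l(w) < k. *)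
Definition shorter (k : nat) (h : hA D) : Prop :=
  forall w, (k <= len w)%N -> tc h w = 0.

Lemma shorter_linear k (x : Zv) h h' :
  shorter k h -> shorter k h' -> shorter k (x *: h + h').
Proof. by move=> s s' w kw; rewrite bcoord_linear s // s' // mulr0 addr0. Qed.

Lemma shorterD k h h' : shorter k h -> shorter k h' -> shorter k (h + h').
Proof. by move=> sh sh0; rewrite -[h]scale1r; apply: shorter_linear. Qed.

Lemma shorter0 k : shorter k 0.
Proof. by move=> w _; rewrite bcoord0. Qed.

Lemma shorterZ k (x : Zv) h : shorter k h -> shorter k (x *: h).
Proof.
by move=> s; rewrite -[_ *: _]addr0; apply: shorter_linear => //; apply: shorter0.
Qed.

Lemma shorterW k k' h : (k <= k')%N -> shorter k h -> shorter k' h.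
Proof. by move=> kk s w kw; apply: s; apply: leq_trans kw. Qed.

Lemma shorterT k w : (len w < k)%N -> shorter k (T w).
Proof.
by move=> wk v kv; rewrite bcoord_basis; case: eqP => // vw; rewrite vw leqNgt wk in kv.
Qed.

(** T_s T_w is T_{sw} if sw is longer, and a combination of T_w and T_{sw} otherwise; in both cases
    the length grows by at most one. *)
Lemma shorter_gen_mul k s h : S s -> shorter k h -> shorter k.+1 (T s * h).
Proof.
move=> Ss sh; have [r ur cov] := bcoord_support (@hT_basis W S L D) h.
rewrite [h](bcoordE ur cov) mulr_sumr big_seq.
apply: big_ind => [||w wr]; [exact: shorter0|exact: shorterD|].
rewrite -scalerAr; have [->|cw] := eqVneq (tc h w) 0.
  by rewrite scale0r; apply: shorter0.
have lw : (len w < k)%N by rewrite ltnNge; apply: contraNN cw => /sh ->.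
apply: shorterZ; have [lsw|lsw] := len_gen_mul cox w Ss.
  by rewrite -hT_gen_mul //; apply: shorterT; rewrite lsw.
have e : T w = T s * T (s * w)%g.
  by rewrite -hT_gen_mul ?mulgA ?(gen_sq cox Ss) ?mul1g.
rewrite e mulrA hT_gen_sqr // mulrDl mul1r -scalerAl -e.
apply: shorter_linear; apply: shorterT; first by rewrite ltnW.
by rewrite ltnS; apply: leq_trans (ltnW lw); rewrite lsw.
Qed.

Lemma hbar_hT_triangular w : shorter (len w) (bar (T w) - T w).
Proof.
have [ws [wd sz] <-] := reduced_exists cox w; rewrite -sz.
elim: ws wd sz => [|s ws IH] /=.
  by rewrite big_nil hT1 rmorph1 subrr => _ _; apply: shorter0.
move=> /word_cons[Ss wd]; rewrite big_cons => sz.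
have le := len_prod cox wd.
have lsw : len (s * \prod_(j <- ws) j)%g = (len (\prod_(j <- ws) j)%g).+1.
  have [//|e] := len_gen_mul cox (\prod_(j <- ws) j)%g Ss.
  by move: le; rewrite e -sz => /ltnW; rewrite ltnn.
have {}sz : size ws = len (\prod_(j <- ws) j)%g.
  by move: sz; rewrite lsw => -[].
have {IH} := IH wd sz; set v := (\prod_(j <- ws) j)%g => sh.
rewrite hT_gen_mul // rmorphM hbar_gen //.
have -> : bar (T v) = (bar (T v) - T v) + T v by rewrite subrK.
set e := _ - T v in sh *.
(* With bar(T_v) = e + T_v and bar(T_s) = T_s - xi, the terms T_s T_v cancel and all that remains
   has length at most l(v). *)
have -> : (T s - xi s *: 1) * (e + T v) - T s * T v =
   (- xi s) *: e + ((- xi s) *: T v + T s * e).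
  rewrite mulrBl mulrDr -scalerAl mul1r scalerDr !scaleNr [LHS]addrAC addrK.
  by rewrite opprD [RHS]addrA [RHS]addrC.
apply: shorter_linear; first exact: shorterW sh.
apply: shorter_linear; first by apply: shorterT; rewrite sz.
exact: shorter_gen_mul.
Qed.

Lemma lrev0 : lrev 0 = 0 :> Zv.
Proof. by rewrite /lrev msupp0 big_seq_fset0. Qed.

(** By triangularity a term T_v with l(v) <= l(w) contributes to T_w after applying bar only if v =
    w. *)
Lemma coord_hbar h w : (forall v, (len w < len v)%N -> tc h v = 0) ->
  tc (bar h) w = lrev (tc h w).
Proof.
move=> above; have [r ur cov] := bcoord_support (@hT_basis W S L D) h.
rewrite {1}[h](bcoordE ur cov) rmorph_sum bcoord_sum.
have term v : tc (bar (tc h v *: T v)) w = lrev (tc h v) * (w == v)%:R.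
  rewrite hbarZ bcoordZ; have [/above->|vw] := ltnP (len w) (len v).
    by rewrite lrev0 !mul0r.
  have := hbar_hT_triangular vw; rewrite bcoordD bcoordN bcoord_basis.
  by move/eqP; rewrite subr_eq0 => /eqP ->.
have [w0|wr] := eqVneq (tc h w) 0.
  rewrite w0 lrev0 big1 // => v _; rewrite term.
  by case: eqP => [<-|_]; rewrite ?w0 ?lrev0 ?mul0r ?mulr0.
rewrite (bigD1_seq w) ?cov //= term eqxx mulr1 big1 ?addr0 // => v vw.
by rewrite term eq_sym (negbTE vw) mulr0.
Qed.

(* The coefficient of a longest T_w in h is fixed by v |-> v^-1, so that it
   cannot lie in v^-1 Z[v^-1]. *)
Lemma bar_invariant_eq0 h : bar h = h ->
  (forall w, deg_le (-1) (tc h w)) -> h = 0.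
Proof.
move=> bh neg; have [r ur cov] := bcoord_support (@hT_basis W S L D) h.
pose m := \max_(v <- r) len v.
(* Descending induction on length from m + 1, above the whole support; k = m + 1 reaches length
   0. *)
suff main k : forall w, (m.+1 - k <= len w)%N -> tc h w = 0.
  by apply: (bcoord_eq0 (bB := @hT_basis W S L D)) => w; apply: (main m.+1); rewrite subnn.
elim: k => [|k IH] w lw.
  apply/eqP; apply: contraTT lw => /cov wr; rewrite subn0 -ltnNge ltnS.
  by apply: (@leq_bigmax_seq _ r xpredT len w).
have rev : lrev (tc h w) = tc h w.
  rewrite -coord_hbar ?bh // => v wv; apply: IH.
  by rewrite subnS in lw; apply: leq_trans (leqSpred _) (leq_ltn_trans lw wv).
apply: laurentP => k'; rewrite lcoef0.
(* Exponents >= 0 are excluded directly, negative ones after the substitution of v^-1 for v. *)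
have [k0|k0] := ltP k' 0; last by apply: neg; apply: lt_le_trans k0.
by rewrite -rev lcoef_lrev; apply: neg; rewrite (@lt_trans _ _ 0) // oppr_gt0.
Qed.

End Hecke.

(** * Inversion and cells *)

(** The quadratic relation with its factors exchanged, as the opposite algebra requires it. *)
Lemma commr_linear (B : algType Zv) (x : B) (k l : Zv) :
  (x + l *: 1) * (x - k *: 1) = (x - k *: 1) * (x + l *: 1).
Proof.
have comm_scalar (y : B) (m : Zv) : GRing.comm y (m *: 1).
  by rewrite /GRing.comm -scalerAl -scalerAr mulr1 mul1r.
apply: commrB; last exact: comm_scalar.
by apply: commr_sym; apply: commrD => //; apply: comm_scalar.
Qed.

Section AntiInvolution.
Variables (W : groupType) (S : set W) (L : W -> int) (D : hecke_datum S L).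
Hypothesis cox : coxeter_system S.

Local Notation T := (hT D).
Local Notation bar := (hbar D).
Local Notation tc := (bcoord (@hT_basis W S L D)).

Definition anti_involution (phi : hA D -> hA D) : Prop :=
  [/\ forall (k : Zv) x y, phi (k *: x + y) = k *: phi x + phi y,
      forall x y, phi (x * y) = phi y * phi x,
      phi 1 = 1 & forall s, S s -> phi (T s) = T s].

Lemma anti_involution_exists : exists phi, anti_involution phi.
Proof.
have [[quad braid] univ] := hT_presentation D.
have rel : hecke_relations S L (T : W -> opp_algebra (hA D)).
  split=> [s Ss|s s' m Ss Ss' ne ord].
    exact: (etrans (commr_linear (T s) _ _) (quad s Ss)).
  rewrite !altprod_opp; have := braid s s' m Ss Ss' ne ord.
  by case: (odd m).
have [[g gT] _] := univ _ _ rel; exists (g : hA D -> hA D); split=> //.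
- by move=> k x y; rewrite linearP.
- by move=> x y; rewrite rmorphM.
- by rewrite rmorph1.
Qed.

Variable phi : hA D -> hA D.
Hypothesis phiP : anti_involution phi.

Lemma phi_lin (k : Zv) x y : phi (k *: x + y) = k *: phi x + phi y.
Proof. by case: phiP. Qed.

Lemma phiM x y : phi (x * y) = phi y * phi x.
Proof. by case: phiP. Qed.

Lemma phi1 : phi 1 = 1.
Proof. by case: phiP. Qed.

Lemma phi_gen s : S s -> phi (T s) = T s.
Proof. by case: phiP => _ _ _; apply. Qed.

Lemma phiD x y : phi (x + y) = phi x + phi y.
Proof. by rewrite -[x]scale1r phi_lin !scale1r. Qed.

Lemma phi0 : phi 0 = 0.
Proof. by apply: (addrI (phi 0)); rewrite -phiD !addr0. Qed.

Lemma phiZ (k : Zv) x : phi (k *: x) = k *: phi x.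
Proof. by rewrite -[_ *: _]addr0 phi_lin phi0 addr0. Qed.

Lemma phi_sum (I : Type) (r : seq I) (F : I -> hA D) :
  phi (\sum_(i <- r) F i) = \sum_(i <- r) phi (F i).
Proof. exact: (big_morph phi phiD phi0). Qed.

Lemma phi_hT w : phi (T w) = T w^-1%g.
Proof.
have [ws red <-] := reduced_exists cox w; have [wd _] := red.
rewrite -(prod_rev cox wd) !hT_reduced //; last exact: reduced_rev.
elim: ws wd {red} => [|s ws IH]; first by rewrite !big_nil phi1.
move=> /word_cons[Ss wd]; rewrite rev_cons -cats1 big_cat big_seq1 big_cons.
by rewrite phiM IH // phi_gen.
Qed.

(** Both composites reverse products, so it suffices to compare them on generators, where bar(T_s) =
    T_s - xi is fixed by [phi]. *)
Lemma phi_hbar_hT w : bar (phi (T w)) = phi (bar (T w)).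
Proof.
have [ws red <-] := reduced_exists cox w; have [wd _] := red.
rewrite hT_reduced //; elim: ws wd {red} => [|s ws IH].
  by rewrite !big_nil rmorph1 phi1 rmorph1.
move=> /word_cons[Ss wd]; rewrite big_cons phiM !rmorphM phiM IH //.
congr (_ * _); rewrite phi_gen // hbar_gen // -scaleNr addrC phi_lin phi1.
by rewrite phi_gen.
Qed.

Lemma phi_hbar h : bar (phi h) = phi (bar h).
Proof.
have [r ur cov] := bcoord_support (@hT_basis W S L D) h.
rewrite [h](bcoordE ur cov) phi_sum !rmorph_sum phi_sum.
by apply: eq_bigr => w _; rewrite phiZ !hbarZ phiZ phi_hbar_hT.
Qed.

Lemma bcoord_phi h w : tc (phi h) w = tc h w^-1%g.
Proof.
have [r ur cov] := bcoord_support (@hT_basis W S L D) h.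
rewrite (@bcoord_unique _ _ _ _ _ (fun w => tc h w^-1%g) [seq v^-1%g | v <- r]) //.
- by rewrite map_inj_uniq //; apply: invg_inj.
- by move=> v /cov vr; apply/mapP; exists v^-1%g; rewrite ?invgK.
rewrite {1}[h](bcoordE ur cov) phi_sum big_map; apply: eq_bigr => v _.
by rewrite phiZ phi_hT invgK.
Qed.

Lemma bcoord_hc w y : tc (hc D w) y = hp D y w.
Proof.
have [r ur cov] := finite_set_seq (hp_finite D w).
rewrite (@bcoord_unique _ _ _ _ _ (fun y => hp D y w) r) //.
by rewrite hc_def (lincomb_seq _ ur cov).
Qed.

Lemma phi_hc w : phi (hc D w) = hc D w^-1%g.
Proof.
apply/eqP; rewrite -subr_eq0; apply/eqP; apply: (bar_invariant_eq0 cox).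
  by rewrite rmorphB phi_hbar !hc_bar.
move=> y k k0; rewrite bcoordD bcoordN bcoord_phi !bcoord_hc.
(* At y = w^-1 the two diagonal coefficients 1 cancel; elsewhere both coefficients lie in v^-1
   Z[v^-1]. *)
have [->|/eqP yw] := eqVneq y w^-1%g; first by rewrite invgK !hp_diag subrr lcoef0.
rewrite lcoefD lcoefN !hp_neg ?subrr //.
by move=> e; apply: yw; rewrite -e invgK.
Qed.

Lemma deg_leW (m k : int) (x : Zv) : m <= k -> deg_le m x -> deg_le k x.
Proof. by move=> mk h j kj; apply: h; apply: le_lt_trans kj. Qed.

(** The matrix p is the identity modulo v^-1. The coordinate at T_y expresses u_y through the
    products u_w p_{y,w} with w <> y, so a common bound on the degrees of all u_w can be lowered by
    one, indefinitely. *)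
Lemma hc_independent (u : W -> Zv) (r : seq W) : uniq r ->
  (forall w, u w != 0 -> w \in r) ->
  \sum_(w <- r) u w *: hc D w = 0 -> forall w, u w = 0.
Proof.
move=> ur cov e.
have out w : w \notin r -> u w = 0.
  by apply: contraNeq => /cov.
have [N degN] : exists N : int, forall w, deg_le N (u w).
  pose f w := sval (cid (deg_le_exists (u w))).
  have fP w : deg_le (f w) (u w) by rewrite /f; case: cid.
  exists (\sum_(w <- r) `|f w|) => w; have [wr|/out ->] := boolP (w \in r); last first.
    by move=> k _; rewrite lcoef0.
  apply: deg_leW (fP w); rewrite (big_rem w) //=.
  by rewrite (le_trans (ler_norm _)) // lerDl sumr_ge0.
have row y : \sum_(w <- r) u w * hp D y w = 0.
  rewrite -[RHS](bcoord0 (@hT_basis W S L D) y) -e bcoord_sum.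
  by apply: eq_bigr => w _; rewrite bcoordZ bcoord_hc.
have main (k : nat) : forall w, deg_le (N - k%:Z) (u w).
  elim: k => [|k IH] y; first by rewrite subr0.
  move=> j lt; have [yr|/out ->] := boolP (y \in r); last by rewrite lcoef0.
  have [/IH //|le] := ltP (N - k%:Z) j.
  have {le lt}-> : j = N - k%:Z.
    by apply/eqP; rewrite eq_le le /=; move: lt;
      rewrite -addn1 PoszD opprD addrA ltrBlDr ltzD1.
  have := congr1 (fun x => lcoef x (N - k%:Z)) (row y).
  rewrite lcoef_sum lcoef0 (bigD1_seq y) //= hp_diag mulr1 big1 ?addr0 // => w wy.
  have yw : y <> w by apply/eqP; rewrite eq_sym.
  by apply: (deg_leM (IH w) (hp_neg D yw)); rewrite gtrDl.
(* After |N - j| + 1 steps the bound has dropped below the exponent j. *)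
move=> w; apply: laurentP => j; rewrite lcoef0; apply: (main `|N - j|.+1).
rewrite -addn1 PoszD opprD addrA ltrBlDr ltzD1 lerBlDr -lerBlDl abszE.
exact: ler_norm.
Qed.

Lemma hh_inv x y z : hh D x y z = hh D y^-1%g x^-1%g z^-1%g.
Proof.
(* The difference of the coefficients of c_z in two expansions of phi(c_x c_y): image of the
   expansion of c_x c_y, and expansion of c_{y^-1} c_{x^-1}. *)
pose u z := hh D x y z^-1%g - hh D y^-1%g x^-1%g z.
suff: u z^-1%g = 0 by rewrite /u invgK => /eqP; rewrite subr_eq0 => /eqP.
have [r1 u1 c1] := finite_set_seq (hh_finite D x y).
have [r2 u2 c2] := finite_set_seq (hh_finite D y^-1%g x^-1%g).
pose r := undup ([seq w^-1%g | w <- r1] ++ r2).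
have ur : uniq r by apply: undup_uniq.
have cov1 w : hh D x y w^-1%g != 0 -> w \in r.
  move=> /c1 wr; rewrite mem_undup mem_cat; apply/orP; left.
  by apply/mapP; exists w^-1%g; rewrite ?invgK.
have cov2 w : hh D y^-1%g x^-1%g w != 0 -> w \in r.
  by move=> /c2 wr; rewrite mem_undup mem_cat wr orbT.
apply: (hc_independent ur) => [w|].
  by rewrite /u; have [->|/cov1 //] := eqVneq (hh D x y w^-1%g) 0;
    rewrite sub0r oppr_eq0 => /cov2.
pose r' := [seq w^-1%g | w <- r].
have ur' : uniq r' by rewrite map_inj_uniq //; apply: invg_inj.
have cov' w : hh D x y w != 0 -> w \in r'.
  by move=> h; apply/mapP; exists w^-1%g; rewrite ?invgK // cov1 ?invgK.
have e1 : phi (hc D x * hc D y) = \sum_(w <- r) hh D x y w^-1%g *: hc D w.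
  rewrite hh_def (lincomb_seq _ ur' cov') phi_sum big_map.
  by apply: eq_bigr => w _; rewrite phiZ phi_hc invgK.
have e2 : phi (hc D x * hc D y) = \sum_(w <- r) hh D y^-1%g x^-1%g w *: hc D w.
  by rewrite phiM !phi_hc hh_def (lincomb_seq _ ur cov2).
rewrite -[RHS](subrr (phi (hc D x * hc D y))) {1}e1 e2 -sumrB.
by apply: eq_bigr => w _; rewrite scalerBl.
Qed.

End AntiInvolution.

(** * Inversion exchanges left and right cells *)

Section Cells.
Variables (W : groupType) (S : set W) (L : W -> int) (D : hecke_datum S L).
Hypothesis cox : coxeter_system S.

Lemma hhV x y z : hh D x y z = hh D y^-1%g x^-1%g z^-1%g.
Proof. by have [phi /hh_inv] := anti_involution_exists D; apply. Qed.

Lemma leL_inv x y : leL D x y -> leR D x^-1%g y^-1%g.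
Proof.
elim=> [u v [s Ss h]|u|u v w _ uv _ vw].
- apply: Relation_Operators.rt_step; exists s => //.
  by rewrite -[s](gen_inv cox Ss) -hhV.
- exact: Relation_Operators.rt_refl.
- exact: Relation_Operators.rt_trans uv vw.
Qed.

Lemma leR_inv x y : leR D x y -> leL D x^-1%g y^-1%g.
Proof.
elim=> [u v [s Ss h]|u|u v w _ uv _ vw].
- apply: Relation_Operators.rt_step; exists s => //.
  by rewrite -[s](gen_inv cox Ss) -hhV.
- exact: Relation_Operators.rt_refl.
- exact: Relation_Operators.rt_trans uv vw.
Qed.

Lemma simL_inv x y : simL D x y -> simR D x^-1%g y^-1%g.
Proof. by move=> [xy yx]; split; apply: leL_inv. Qed.

Lemma simR_inv x y : simR D x y -> simL D x^-1%g y^-1%g.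
Proof. by move=> [xy yx]; split; apply: leR_inv. Qed.

Lemma simL_sym x y : simL D x y -> simL D y x.
Proof. by case. Qed.

Lemma simL_trans x y z : simL D x y -> simL D y z -> simL D x z.
Proof.
move=> [xy yx] [yz zy]; split.
  exact: Relation_Operators.rt_trans xy yz.
exact: Relation_Operators.rt_trans zy yx.
Qed.

Lemma simR_sym x y : simR D x y -> simR D y x.
Proof. by case. Qed.

Lemma simR_trans x y z : simR D x y -> simR D y z -> simR D x z.
Proof.
move=> [xy yx] [yz zy]; split.
  exact: Relation_Operators.rt_trans xy yz.
exact: Relation_Operators.rt_trans zy yx.
Qed.

End Cells.

(** * Admissible sums *)

Section AdmissibleSums.
Variables (W : groupType) (S : set W) (L : W -> int) (D : hecke_datum S L).
Variables (a Delta : W -> nat) (n : W -> int) (A : comPzRingType).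
Hypothesis cox : coxeter_system S.
Hypothesis P : P1_to_P15 D a Delta n.
Implicit Types (f g h : W -> A^o).

Local Notation c := (J_coef D a).
Local Notation cop := (fun x y => J_coef D a y x).
Local Notation e := (sum_n_t a Delta n A).

Lemma convE f g : conv D a f g = convolution c f g.
Proof. by []. Qed.

Lemma convE_op f g : conv D a f g = convolution cop g f.
Proof. by rewrite convolutionC. Qed.

Lemma left_admissibleE :
  @left_admissible W S L D A = admissible (A := A) (simL D).
Proof.
apply/seteqP; split=> f af.
  move=> w; apply: sub_finite_set (af [set x | simL D x w] _); last by exists w.
  by move=> x [/eqP fx xw].
move=> _ [w ->]; apply: sub_finite_set (af w) => x [/= fx xw].
by split=> //; apply/eqP.
Qed.

Lemma right_admissibleE :
  @right_admissible W S L D A = admissible (A := A) (simR D).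
Proof.
apply/seteqP; split=> f af.
  move=> w; apply: sub_finite_set (af [set x | simR D x w] _); last by exists w.
  by move=> x [/eqP fx xw].
move=> _ [w ->]; apply: sub_finite_set (af w) => x [/= fx xw].
by split=> //; apply/eqP.
Qed.

Lemma finitely_supportedE :
  @finitely_supported W A = admissible (A := A) (fun _ _ : W => True).
Proof.
apply/seteqP; split=> f af.
  by move=> w; apply: sub_finite_set af => x [/eqP fx _].
by apply: sub_finite_set (af 1%g) => x /= /eqP fx.
Qed.

Lemma J_coef_simL_r x y z : c x y z != 0 -> simL D y z.
Proof. by move=> /(J_coef_simL P)[]. Qed.

Lemma J_coef_simL_l x y z : c x y z != 0 -> simL D x y^-1%g.
Proof. by move=> /(J_coef_simL P)[]. Qed.

(** The third relation of P8 compares z^-1 with y^-1 in left cells; inversion turns it into a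
    relation between z and y in right cells. *)
Lemma J_coef_simR_r x y z : cop x y z != 0 -> simR D y z.
Proof.
move=> /(J_coef_simL P)[_ _ /(simL_inv cox)]; rewrite !invgK.
exact: simR_sym.
Qed.

Lemma J_coef_simR_l x y z : cop x y z != 0 -> simR D x y^-1%g.
Proof.
move=> /(J_coef_simL P)[/(simL_inv cox) + _ _]; rewrite invgK.
exact: simR_sym.
Qed.

Lemma J_coef_op_finite x y : finite_set [set z | cop x y z != 0].
Proof. exact: J_coef_finite. Qed.

Lemma J_coef_opA x u v z : \sum_(y \in [set: W]) cop x y z * cop u v y =
                           \sum_(y \in [set: W]) cop x u y * cop y v z.
Proof.
transitivity (\sum_(y \in [set: W]) c v u y * c y x z).
  by apply: eq_fsbigr => y _; rewrite mulrC.
by rewrite -(J_coefA P); apply: eq_fsbigr => y _; rewrite mulrC.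
Qed.

Lemma sum_n_t_distinguished d : e d <> 0 -> distinguished a Delta d.
Proof. by rewrite /sum_n_t; case: asboolP. Qed.

(** By P5 the product is n_d^2 with n_d = 1 or -1; uniqueness of d is that in P3. *)
Lemma sum_n_t_gamma y : exists d, e d * (gamma D a y^-1%g y d)%:~R = 1 :> A /\
  forall d', e d' <> 0 -> gamma D a y^-1%g y d' != 0 -> d' = d.
Proof.
have [d [[Dd gd] uniq]] := P3 P y; exists d; split.
  have [-> nd] := P5 P Dd gd; rewrite /sum_n_t; case: asboolP => // _.
  by case: nd => ->; rewrite ?mulr1 // rmorphN1 mulrNN mulr1.
by move=> d' /sum_n_t_distinguished Dd' gd'; apply/esym/uniq.
Qed.

(** The cyclic symmetry P7 moves the index of the unit element to the third place, where P2 gives y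
    = z and P3 singles out d. On the right the same takes two rotations. *)
Lemma conv_unit_l f : conv D a e f = f.
Proof.
rewrite convE; apply: convolution_unit_l => z; have [d [ed ud]] := sum_n_t_gamma z^-1%g.
rewrite invgK in ed ud; exists d; rewrite /J_coef (P7 P); split=> //.
move=> x y ex; rewrite (P7 P) => cz.
have yz : y = z by rewrite -[z]invgK; apply: (P2 P) (sum_n_t_distinguished ex) cz.
by rewrite yz in cz *; split=> //; apply: ud.
Qed.

Lemma conv_unit_r f : conv D a f e = f.
Proof.
rewrite convE_op; apply: convolution_unit_l => z.
have [d [ed ud]] := sum_n_t_gamma z; exists d; rewrite /J_coef 2!(P7 P); split=> //.
move=> x y ex; rewrite 2!(P7 P) => cz.
have yz : y = z.
  by apply: invg_inj; rewrite -(P2 P (sum_n_t_distinguished ex) cz).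
by rewrite yz in cz *; split=> //; apply: ud.
Qed.

Lemma distinguished_simL_finite w :
  finite_set [set x | distinguished a Delta x /\ simL D x w].
Proof.
have [|d [_ _ ud _]] := P13 P (C := [set x | simL D x w]); first by exists w.
apply: sub_finite_set (finite_set1 d) => x [Dx xw]; exact: ud.
Qed.

Lemma sum_n_t_left_admissible : admissible (A := A) (simL D) e.
Proof.
move=> w; apply: sub_finite_set (distinguished_simL_finite w) => x [ex xw].
by split=> //; apply: sum_n_t_distinguished.
Qed.

(* A distinguished element is an involution, so inversion carries right cells
   to left cells without moving it. *)
Lemma sum_n_t_right_admissible : admissible (A := A) (simR D) e.
Proof.
move=> w; apply: sub_finite_set (distinguished_simL_finite w^-1%g) => x [ex xw].
have Dx := sum_n_t_distinguished ex; split=> //.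
have -> : x = x^-1%g.
  by apply: (@mulgI _ x); rewrite mulgV -expg2 (P6 P).
exact: (simR_inv cox).
Qed.

Lemma admissible_submodule (E : W -> W -> Prop) :
  is_submodule (admissible (A := A) E).
Proof. by split=> [|b f g]; [apply: admissible0|apply: admissible_linear]. Qed.

Lemma left_unital_algebra : is_unital_algebra D a (admissible (A := A) (simL D)) e.
Proof.
have sL := @simL_sym _ _ _ D; have tL := @simL_trans _ _ _ D.
have fin := @J_coef_finite _ _ _ D a.
split.
- exact: admissible_submodule.
- move=> f g; exact: (admissible_convolution tL fin J_coef_simL_r J_coef_simL_l).
- move=> b f f' g; exact: (admissible_convolution_linear_l J_coef_simL_r J_coef_simL_l).
- move=> b f g g'; exact: (admissible_convolution_linear_r J_coef_simL_r J_coef_simL_l).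
- move=> f g h; apply: (admissible_convolutionA tL fin J_coef_simL_r J_coef_simL_l).
  exact: J_coefA P.
- exact: sum_n_t_left_admissible.
- by move=> f _; apply: conv_unit_l.
- by move=> f _; apply: conv_unit_r.
Qed.

Lemma right_unital_algebra : is_unital_algebra D a (admissible (A := A) (simR D)) e.
Proof.
have sR := @simR_sym _ _ _ D; have tR := @simR_trans _ _ _ D.
split.
- exact: admissible_submodule.
- move=> f g af ag; rewrite convE_op.
  exact: (admissible_convolution tR J_coef_op_finite J_coef_simR_r J_coef_simR_l).
- move=> b f f' g af af' ag; rewrite !convE_op.
  exact: (admissible_convolution_linear_r J_coef_simR_r J_coef_simR_l).
- move=> b f g g' af ag ag'; rewrite !convE_op.
  exact: (admissible_convolution_linear_l J_coef_simR_r J_coef_simR_l).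
(* Passing to the opposite constants exchanges the two bracketings. *)
- move=> f g h af ag ah; rewrite !convE_op; apply/esym.
  apply: (admissible_convolutionA tR J_coef_op_finite J_coef_simR_r J_coef_simR_l) => //.
  exact: J_coef_opA.
- exact: sum_n_t_right_admissible.
- by move=> f _; apply: conv_unit_l.
- by move=> f _; apply: conv_unit_r.
Qed.

Lemma left_conv_defined f g : admissible (simL D) f -> admissible (simL D) g ->
  conv_defined D a f g.
Proof.
move=> af ag z; exact: (convolution_terms_finite J_coef_simL_r J_coef_simL_l).
Qed.

Lemma right_conv_defined f g : admissible (simR D) f -> admissible (simR D) g ->
  conv_defined D a f g.
Proof.
move=> af ag z; have fin := finite_image (fun p : W * W => (p.2, p.1))
  (convolution_terms_finite J_coef_simR_r J_coef_simR_l z ag af).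
apply: sub_finite_set fin => -[x y] /= h; exists (y, x) => //=.
by rewrite [g y * _]mulrC.
Qed.

Lemma finitely_supported_conv f g : finitely_supported f -> finitely_supported g ->
  finitely_supported (conv D a f g).
Proof.
rewrite finitely_supportedE => af ag.
(* For the trivial relation any map can serve as [inv]. *)
by apply: (admissible_convolution (inv := id) _ (@J_coef_finite _ _ _ D a)).
Qed.

Lemma conv_J_mul f g : finitely_supported f -> finitely_supported g ->
  conv D a f g = J_mul D a f g.
Proof.
move=> ff fg; have [r ur cov] : exists2 r : seq W, uniq r &
    forall x, ([set w | f w != 0] `|` [set w | g w != 0]) x -> x \in r.
  by apply: finite_set_seq; rewrite finite_setU.
apply/funext => z; rewrite convE (@convolution_seq _ _ _ _ _ _ r) //; last first.
  by move=> x y fx gy _; split; apply: cov; [left|right]; apply/eqP.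
rewrite /J_mul.
(* [G x y] is the product t_x t_y, and [GE] reads off its coefficient at z. *)
pose G x y : W -> A^o := \sum_(z \in [set: W]) ((c x y z)%:~R : A) *: t_ A z.
have GE x y : G x y z = (c x y z)%:~R.
  have [r' ur' cov'] := finite_set_seq (@J_coef_finite _ _ _ D a x y).
  rewrite /G (fsum_seq (r := r')) //; last first.
    move=> w h; apply: cov'; apply/eqP => c0; apply: h.
    by rewrite c0 scale0r.
  rewrite fct_sumE.
  have tE w : (((c x y w)%:~R : A) *: t_ A w) z = (c x y w)%:~R * (z == w)%:R :> A.
    by [].
  have [c0|cz] := eqVneq (c x y z) 0.
    rewrite c0 big1 // => w _; rewrite tE.
    by case: eqP => [<-|_]; rewrite ?c0 ?mul0r ?mulr0.
  rewrite (bigD1_seq z) ?cov' //= tE eqxx mulr1 big1 ?addr0 // => w wz.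
  by rewrite tE eq_sym (negbTE wz) mulr0.
have inner x : \sum_(y \in [set: W]) ((f x : A) * g y) *: G x y =
               \sum_(y <- r) ((f x : A) * g y) *: G x y.
  apply: fsum_seq => // y h; apply: cov; right; apply/eqP => g0; apply: h.
  by rewrite g0 mulr0 scale0r.
have -> : \sum_(x \in [set: W]) \sum_(y \in [set: W]) ((f x : A) * g y) *: G x y =
          \sum_(x <- r) \sum_(y <- r) ((f x : A) * g y) *: G x y.
  transitivity (\sum_(x <- r) \sum_(y \in [set: W]) ((f x : A) * g y) *: G x y).
    apply: fsum_seq => // x h; apply: cov; left; apply/eqP => f0; apply: h.
    by apply: fsbig1 => y _; rewrite f0 mul0r scale0r.
  by apply: eq_bigr => x _; rewrite inner.
rewrite fct_sumE; apply: eq_bigr => x _; rewrite fct_sumE.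
by apply: eq_bigr => y _; rewrite -GE.
Qed.

Lemma finitely_supported_left : @finitely_supported W A `<=` admissible (simL D).
Proof. by move=> f ff w; apply: sub_finite_set ff => x [/eqP]. Qed.

Lemma finitely_supported_right : @finitely_supported W A `<=` admissible (simR D).
Proof. by move=> f ff w; apply: sub_finite_set ff => x [/eqP]. Qed.

End AdmissibleSums.

Theorem mainTheorem7 (W : groupType) (S : set W) (L : W -> int)
    (D : hecke_datum S L) (a Delta : W -> nat) (n : W -> int)
    (A : comPzRingType) :
  coxeter_system S ->
  weight_function S L ->
  (forall s, S s -> 0 < L s) ->
  bounded D ->
  is_a_function D a ->
  is_Delta_n D Delta n ->
  P1_to_P15 D a Delta n ->
  (* (i) *)
  [/\ (forall f g : W -> A^o, left_admissible D f -> left_admissible D g ->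
        conv_defined D a f g /\ left_admissible D (conv D a f g))
    & (forall f g : W -> A^o, right_admissible D f -> right_admissible D g ->
        conv_defined D a f g /\ right_admissible D (conv D a f g))] /\
  (* (ii) *)
  [/\ is_unital_algebra D a (@left_admissible W S L D A) (sum_n_t a Delta n A)
    & is_unital_algebra D a (@right_admissible W S L D A)
        (sum_n_t a Delta n A)] /\
  (* (iii) *)
  (let J := @left_admissible W S L D A `&` @right_admissible W S L D A in
  [/\ is_subalgebra D a J (@left_admissible W S L D A),
      is_subalgebra D a J (@right_admissible W S L D A),
      J (sum_n_t a Delta n A),
      is_subalgebra D a (@finitely_supported W A) J
    & forall f g : W -> A^o, finitely_supported f -> finitely_supported g ->
        conv D a f g = J_mul D a f g]).
Proof.
move=> cox _ _ _ _ _ P; rewrite left_admissibleE right_admissibleE.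
have lalg := left_unital_algebra A P; have ralg := right_unital_algebra A cox P.
split; [|split; [by split|]].
  split=> f g af ag.
    by split; [exact: (left_conv_defined P af ag)|exact: (algebra_conv lalg af ag)].
  by split; [exact: (right_conv_defined cox P af ag)|exact: (algebra_conv ralg af ag)].
have submod : is_submodule (admissible (A := A) (simL D) `&` admissible (simR D)).
  have [l0 ll] := algebra_submodule lalg; have [r0 rl] := algebra_submodule ralg.
  by split=> // b f g [lf rf] [lg rg]; split; [apply: ll|apply: rl].
have Jconv (f g : W -> A^o) : (admissible (simL D) `&` admissible (simR D)) f ->
    (admissible (simL D) `&` admissible (simR D)) g ->
    (admissible (simL D) `&` admissible (simR D)) (conv D a f g).
  move=> [lf rf] [lg rg].
  by split; [apply: (algebra_conv lalg lf lg)|apply: (algebra_conv ralg rf rg)].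
split.
- by split=> // f [].
- by split=> // f [].
- by split; [exact: (algebra_one lalg)|exact: (algebra_one ralg)].
- split.
  + move=> f ff; split; first exact: finitely_supported_left.
    exact: finitely_supported_right.
  + by rewrite finitely_supportedE; apply: admissible_submodule.
  + exact: finitely_supported_conv.
- exact: conv_J_mul.
Qed.
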